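(* Let $k$ be an algebraically closed field of characteristic either $2$ or $3$, and let $X:=\operatorname{Spec} k[[x^2,x^3]]$. Then for every $n\in\mathbb{N}_0$, $\mathrm{Nash}_n(X)\cong X$.
   Context: $\mathbb{N}_0=\{0,1,2,\dots\}$. Nash blowup of a coherent sheaf: let $Y$ be a reduced Noetherian scheme and $\mathcal{M}$ a coherent $\mathcal{O}_Y$-module that is locally free of constant rank $r$ on an open dense subscheme $U\subseteq Y$. Let $\mathrm{Grass}_r(\mathcal{M})$ be the Grassmannian $Y$-scheme of rank $r$ locally free quotients of $\mathcal{M}$; then $\mathrm{Grass}_r(\mathcal{M})\times_Y U\cong U$. The Nash blowup $\mathrm{Nash}(Y,\mathcal{M})$ is the closure of $\mathrm{Grass}_r(\mathcal{M})\times_Y U$ in $\mathrm{Grass}_r(\mathcal{M})$. Higher Nash blowup in the complete case: let $R = k[[x_1,\dots,x_r]]/\mathfrak{b}$ and $X=\operatorname{Spec} R$, reduced of pure dimension $d$. Let $\hat I_R\subseteq R\hat\otimes_k R$ be the ideal generated by the elements $x_i\otimes 1-1\otimes x_i$, and put $\hat P^n_R := R\hat\otimes_k R/\hat I_R^{\,n+1}$, regarded as an $R$-module via $a\mapsto a\otimes 1$ (it is finitely generated). Let $\hat{\mathcal{P}}^n_X$ be the associated coherent $\mathcal{O}_X$-module. If $\hat{\mathcal{P}}^n_X$ is locally free of constant rank $\binom{n+d}{d}$ on an open dense subset (which holds for the $X$ in the claim, with $d=1$), then $\mathrm{Nash}_n(X):=\mathrm{Nash}(X,\hat{\mathcal{P}}^n_X)$.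 *)

(* Defs.v *)
From HB Require Import structures.
From mathcomp Require Import all_boot all_order all_algebra.
From mathcomp Require Import zify.
From mathcomp Require Import boolp classical_sets functions.

Set Implicit Arguments.
Unset Strict Implicit.
Unset Printing Implicit Defensive.

Import GRing.Theory.
Local Open Scope ring_scope.
Local Open Scope classical_set_scope.
Local Open Scope quotient_scope.

(* Rings may be zero ([comPzRingType]): functors of points are evaluated on the
   zero ring as well. *)

Lemma rmorph_ext (A B : pzSemiRingType) (f g : {rmorphism A -> B}) :
  f =1 g -> f = g.
Proof.
case: f g => f [[f1] [f2]] [g [[g1] [g2]]] /= /funext E.
move: g1 g2; rewrite -E => g1 g2.
by rewrite (Prop_irrelevance f1 g1) (Prop_irrelevance f2 g2).
Qed.

Definition span (A : pzRingType) (V : lmodType A) (S : set V) : set V :=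
  [set v | exists m (c : 'I_m -> A) (s : 'I_m -> V),
     (forall i, S (s i)) /\ v = \sum_(i < m) c i *: s i].

Definition submodule (A : pzRingType) (V : lmodType A) (K : set V) : Prop :=
  K 0 /\ forall a u v, K u -> K v -> K (a *: u + v).

Definition ideal (A : comPzRingType) (I : set A) : Prop :=
  submodule (I : set A^o).

Definition ideal_gen (A : comPzRingType) (S : set A) : set A :=
  span (S : set A^o).

(* The [n]-th power of the ideal generated by [S]. *)
Definition ideal_pow (A : comPzRingType) (S : set A) (n : nat) : set A :=
  ideal_gen [set a | exists s : 'I_n -> A,
    (forall i, S (s i)) /\ a = \prod_(i < n) s i].

Section SpanTheory.
Variables (A : pzRingType) (V : lmodType A).
Implicit Types S K : set V.

Lemma span_submodule S : submodule (span S).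
Proof.
split; first by exists 0%N, (fun=> 0), (fun=> 0); split=> [[]//|]; rewrite big_ord0.
move=> a u v [m [c [s [sS ->]]]] [m' [c' [s' [sS' ->]]]].
exists (m + m')%N,
  (fun i : 'I_(m + m') => match fintype.split i with inl j => a * c j | inr j => c' j end),
  (fun i : 'I_(m + m') => match fintype.split i with inl j => s j | inr j => s' j end); split.
  by move=> i; case: (fintype.split i).
rewrite big_split_ord scaler_sumr; congr (_ + _); apply: eq_bigr => i _.
  by rewrite (unsplitK (inl i)) scalerA.
by rewrite (unsplitK (inr i)).
Qed.

Lemma span_sub S v : S v -> span S v.
Proof.
move=> Sv; exists 1%N, (fun=> 1), (fun=> v); split=> //.
by rewrite big_ord1 scale1r.
Qed.

Lemma span_min S K : submodule K -> S `<=` K -> span S `<=` K.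
Proof.
move=> [K0 KD] SK v [m [c [s [sS ->]]]].
elim/big_rec: _ => // i x _ Kx; apply: KD => //; exact: SK.
Qed.

End SpanTheory.

Section IdealTheory.
Variables (A : comPzRingType) (S : set A).

Lemma ideal_gen_ideal : ideal (ideal_gen S).
Proof. exact: (@span_submodule A A^o). Qed.

Lemma ideal_gen0 : ideal_gen S 0. Proof. by case: ideal_gen_ideal. Qed.

Lemma ideal_genD x y : ideal_gen S x -> ideal_gen S y -> ideal_gen S (x + y).
Proof. by move=> Sx Sy; rewrite -[x]mul1r; apply: ideal_gen_ideal.2. Qed.

Lemma ideal_genM a x : ideal_gen S x -> ideal_gen S (a * x).
Proof.
by move=> Sx; rewrite -[_ * _]addr0; apply: ideal_gen_ideal.2 ideal_gen0.
Qed.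

Lemma ideal_genN x : ideal_gen S x -> ideal_gen S (- x).
Proof. by move=> Sx; rewrite -mulN1r; apply: ideal_genM. Qed.

End IdealTheory.

Section QuotientRing.
Variables (A : comPzRingType) (S : set A).

Definition quot_rel : rel A := fun x y => `[< ideal_gen S (x - y) >].

Lemma quot_relP x y : reflect (ideal_gen S (x - y)) (quot_rel x y).
Proof. exact: asboolP. Qed.

Lemma quot_rel_equiv : equiv_class_of quot_rel.
Proof.
split=> [x|x y|y x z].
- by apply/quot_relP; rewrite subrr; apply: ideal_gen0.
- by apply/quot_relP/quot_relP => /ideal_genN; rewrite opprB.
- move=> /quot_relP xy /quot_relP yz; apply/quot_relP.
  by rewrite -[x](subrK y) -addrA; apply: ideal_genD.
Qed.

Canonical quot_rel_equivRel := EquivRelPack quot_rel_equiv.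

Definition quot_ring := {eq_quot quot_rel}.
HB.instance Definition _ := Choice.on quot_ring.
HB.instance Definition _ := EqQuotient.on quot_ring.

Definition quot_proj (a : A) : quot_ring := \pi_quot_ring a.

Lemma quot_projP x y :
  (quot_proj x = quot_proj y) <-> ideal_gen S (x - y).
Proof.
split=> [/eqP|xy]; first by rewrite /quot_proj piE => /quot_relP.
by apply/eqP; rewrite /quot_proj piE; apply/quot_relP.
Qed.

Definition quot_zero : quot_ring := quot_proj 0.
Definition quot_one : quot_ring := quot_proj 1.
Definition quot_opp (x : quot_ring) := quot_proj (- repr x).
Definition quot_add (x y : quot_ring) := quot_proj (repr x + repr y).
Definition quot_mul (x y : quot_ring) := quot_proj (repr x * repr y).

Fact quot_reprP x : ideal_gen S (repr (quot_proj x) - x).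
Proof. by apply/quot_projP; rewrite /quot_proj reprK. Qed.

Fact quot_projN x : quot_opp (quot_proj x) = quot_proj (- x).
Proof. by apply/quot_projP; rewrite -opprD; apply/ideal_genN/quot_reprP. Qed.

Fact quot_projD x y : quot_add (quot_proj x) (quot_proj y) = quot_proj (x + y).
Proof. by apply/quot_projP; rewrite opprD addrACA; apply/ideal_genD/quot_reprP/quot_reprP. Qed.

Fact quot_projM x y : quot_mul (quot_proj x) (quot_proj y) = quot_proj (x * y).
Proof.
apply/quot_projP.
rewrite -[_ * _](subrK (repr (quot_proj x) * y)) -addrA -mulrBr -mulrBl.
apply: ideal_genD; first exact/ideal_genM/quot_reprP.
by rewrite mulrC; apply/ideal_genM/quot_reprP.
Qed.

Fact quot_projE (x : quot_ring) : x = quot_proj (repr x).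
Proof. by rewrite /quot_proj reprK. Qed.

Fact quot_addA : associative quot_add.
Proof.
by move=> x y z; rewrite (quot_projE x) (quot_projE y) (quot_projE z) !quot_projD addrA.
Qed.
Fact quot_addC : commutative quot_add.
Proof. by move=> x y; rewrite (quot_projE x) (quot_projE y) !quot_projD addrC. Qed.
Fact quot_add0 : left_id quot_zero quot_add.
Proof. by move=> x; rewrite (quot_projE x) quot_projD add0r. Qed.
Fact quot_addN : left_inverse quot_zero quot_opp quot_add.
Proof. by move=> x; rewrite (quot_projE x) quot_projN quot_projD addNr. Qed.
HB.instance Definition _ :=
  GRing.isZmodule.Build quot_ring quot_addA quot_addC quot_add0 quot_addN.

Fact quot_mulA : associative quot_mul.
Proof.
by move=> x y z; rewrite (quot_projE x) (quot_projE y) (quot_projE z) !quot_projM mulrA.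
Qed.
Fact quot_mulC : commutative quot_mul.
Proof. by move=> x y; rewrite (quot_projE x) (quot_projE y) !quot_projM mulrC. Qed.
Fact quot_mul1 : left_id quot_one quot_mul.
Proof. by move=> x; rewrite (quot_projE x) quot_projM mul1r. Qed.
Fact quot_mulDl : left_distributive quot_mul quot_add.
Proof.
move=> x y z; rewrite (quot_projE x) (quot_projE y) (quot_projE z).
by rewrite quot_projD !quot_projM quot_projD mulrDl.
Qed.
HB.instance Definition _ := GRing.Zmodule_isComPzRing.Build quot_ring
  quot_mulA quot_mulC quot_mul1 quot_mulDl.

Fact quot_proj_zmod : zmod_morphism quot_proj.
Proof. by move=> x y; rewrite -quot_projD -quot_projN. Qed.
Fact quot_proj_monoid : monoid_morphism quot_proj.
Proof. by split=> // x y; rewrite -quot_projM. Qed.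
HB.instance Definition _ :=
  GRing.isZmodMorphism.Build A quot_ring quot_proj quot_proj_zmod.
HB.instance Definition _ :=
  GRing.isMonoidMorphism.Build A quot_ring quot_proj quot_proj_monoid.

End QuotientRing.

(* [restr phi] is the ring [A], seen as an [R]-module through [phi]. *)
Definition restr (R A : comPzRingType) (phi : {rmorphism R -> A}) : Type := A.

Section Restr.
Variables (R A : comPzRingType) (phi : {rmorphism R -> A}).

HB.instance Definition _ := GRing.ComPzRing.copy (restr phi) A.

Definition restr_scale (r : R) (a : restr phi) : restr phi := phi r * (a : A).

Fact restr_scaleA a b v : restr_scale a (restr_scale b v) = restr_scale (a * b) v.
Proof. by rewrite /restr_scale rmorphM mulrA. Qed.
Fact restr_scale1 : left_id 1 restr_scale.
Proof. by move=> v; rewrite /restr_scale rmorph1 mul1r. Qed.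
Fact restr_scaleDr : right_distributive restr_scale +%R.
Proof. by move=> a u v; apply: mulrDr. Qed.
Fact restr_scaleDl v : {morph restr_scale^~ v : a b / a + b}.
Proof. by move=> a b; rewrite /restr_scale rmorphD mulrDl. Qed.
HB.instance Definition _ := GRing.Zmodule_isLmodule.Build R (restr phi)
  restr_scaleA restr_scale1 restr_scaleDr restr_scaleDl.

Lemma restr_scaleE (r : R) (a : restr phi) : r *: a = phi r * (a : A).
Proof. by []. Qed.

End Restr.

Definition bilinear_map (k : pzRingType) (M N V : lmodType k)
    (f : M -> N -> V) : Prop :=
  (forall m, linear (f m)) /\ (forall n, linear (f^~ n)).

(* [tensor M N] consists of the finite formal sums of pairs; two of them are
   identified when no bilinear map distinguishes them, i.e. modulo the
   smallest congruence making the pairing bilinear. *)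
Section Tensor.
Variables (k : comPzRingType) (M N : lmodType k).

Definition fsum_eval (V : zmodType) (f : M -> N -> V) (s : seq (M * N)) : V :=
  \sum_(p <- s) f p.1 p.2.

Definition tensor_rel : rel (seq (M * N)) := fun s t =>
  `[< forall (V : lmodType k) (f : M -> N -> V),
        bilinear_map f -> fsum_eval f s = fsum_eval f t >].

Lemma tensor_rel_equiv : equiv_class_of tensor_rel.
Proof.
split=> [x|x y|y x z].
- exact/asboolP.
- by apply/asboolP/asboolP => xy V f fB; rewrite xy.
- by move=> /asboolP xy /asboolP yz; apply/asboolP => V f fB; rewrite xy ?yz.
Qed.

Canonical tensor_rel_equivRel := EquivRelPack tensor_rel_equiv.

Definition tensor := {eq_quot tensor_rel}.
HB.instance Definition _ := Choice.on tensor.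
HB.instance Definition _ := EqQuotient.on tensor.

Definition fsum (s : seq (M * N)) : tensor := \pi_tensor s.
Definition pure (m : M) (n : N) : tensor := fsum [:: (m, n)].

Lemma fsumP s t : (fsum s = fsum t) <->
  forall (V : lmodType k) (f : M -> N -> V),
    bilinear_map f -> fsum_eval f s = fsum_eval f t.
Proof.
split=> [/eqP|st]; first by rewrite /fsum piE => /asboolP.
by apply/eqP; rewrite /fsum piE; apply/asboolP.
Qed.

Lemma fsum_repr (x : tensor) : fsum (repr x) = x.
Proof. by rewrite /fsum reprK. Qed.

Lemma eval_repr s (V : lmodType k) (f : M -> N -> V) :
  bilinear_map f -> fsum_eval f (repr (fsum s)) = fsum_eval f s.
Proof. by move=> fB; apply: ((fsumP _ _).1 _ V f fB); rewrite fsum_repr. Qed.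

Lemma eval_cat (V : zmodType) (f : M -> N -> V) s t :
  fsum_eval f (s ++ t) = fsum_eval f s + fsum_eval f t.
Proof. exact: big_cat. Qed.

Definition fsum_opp (s : seq (M * N)) := [seq (- p.1, p.2) | p <- s].

Lemma eval_opp (V : lmodType k) (f : M -> N -> V) s :
  bilinear_map f -> fsum_eval f (fsum_opp s) = - fsum_eval f s.
Proof.
move=> [_ fB]; rewrite /fsum_eval big_map -sumrN; apply: eq_bigr => p _ /=.
have f0 : f 0 p.2 = 0.
  apply: (addrI (f 0 p.2)); rewrite addr0 -{3}(addr0 (0 : M)) -{3}(scale1r 0).
  by rewrite fB scale1r.
by have := fB p.2 (-1) p.1 0; rewrite addr0 f0 addr0 !scaleN1r.
Qed.

Definition tensor_zero : tensor := fsum [::].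
Definition tensor_opp (x : tensor) := fsum (fsum_opp (repr x)).
Definition tensor_add (x y : tensor) := fsum (repr x ++ repr y).

Fact tensor_fsumN s : tensor_opp (fsum s) = fsum (fsum_opp s).
Proof. by apply/fsumP => V f fB; rewrite !eval_opp // eval_repr. Qed.

Fact tensor_fsumD s t : tensor_add (fsum s) (fsum t) = fsum (s ++ t).
Proof. by apply/fsumP => V f fB; rewrite !eval_cat !eval_repr. Qed.

Fact tensor_addA : associative tensor_add.
Proof.
move=> x y z; rewrite -(fsum_repr x) -(fsum_repr y) -(fsum_repr z).
by rewrite !tensor_fsumD catA.
Qed.
Fact tensor_addC : commutative tensor_add.
Proof.
move=> x y; rewrite -(fsum_repr x) -(fsum_repr y) !tensor_fsumD.
by apply/fsumP => V f fB; rewrite !eval_cat addrC.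
Qed.
Fact tensor_add0 : left_id tensor_zero tensor_add.
Proof. by move=> x; rewrite -(fsum_repr x) tensor_fsumD. Qed.
Fact tensor_addN : left_inverse tensor_zero tensor_opp tensor_add.
Proof.
move=> x; rewrite -(fsum_repr x) tensor_fsumN tensor_fsumD; apply/fsumP => V f fB.
by rewrite eval_cat eval_opp // addNr /fsum_eval big_nil.
Qed.
HB.instance Definition _ := GRing.isZmodule.Build tensor
  tensor_addA tensor_addC tensor_add0 tensor_addN.

Lemma fsum_cat s t : fsum (s ++ t) = fsum s + fsum t.
Proof. by rewrite -tensor_fsumD. Qed.

Lemma fsum_oppE s : fsum (fsum_opp s) = - fsum s.
Proof. by rewrite -tensor_fsumN. Qed.

End Tensor.

(* [ext phi M] is the [A]-module obtained from the [R]-module [M] by extension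
   of scalars along [phi : R -> A]. *)
Definition ext (R A : comPzRingType) (phi : {rmorphism R -> A})
  (M : lmodType R) : Type := tensor M (restr phi).

Section Ext.
Variables (R A : comPzRingType) (phi : {rmorphism R -> A}) (M : lmodType R).

HB.instance Definition _ := GRing.Zmodule.copy (ext phi M) (tensor M (restr phi)).

Definition ext_fscale (a : A) (s : seq (M * restr phi)) : seq (M * restr phi) :=
  [seq (p.1, (a * (p.2 : A) : A) : restr phi) | p <- s].

Definition ext_scale (a : A) (x : ext phi M) : ext phi M :=
  fsum (ext_fscale a (repr (x : tensor M (restr phi)))).

Fact ext_bilin_scale (a : A) (V : lmodType R) (f : M -> restr phi -> V) :
  bilinear_map f -> bilinear_map (fun (m : M) (b : restr phi) => f m ((a * (b : A) : A) : restr phi)).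
Proof.
move=> [f1 f2]; split=> [m r b b'|b]; last exact: f2.
rewrite -f1; congr f; rewrite restr_scaleE [LHS]mulrDr.
by rewrite restr_scaleE mulrCA.
Qed.

Fact ext_eval_scale (a : A) (V : lmodType R) (f : M -> restr phi -> V) s :
  fsum_eval f (ext_fscale a s) =
  fsum_eval (fun (m : M) (b : restr phi) => f m ((a * (b : A) : A) : restr phi)) s.
Proof. by rewrite /fsum_eval big_map. Qed.

Fact ext_fsumZ a s : ext_scale a (fsum s) = fsum (ext_fscale a s).
Proof.
by apply/fsumP => V f fB; rewrite !ext_eval_scale eval_repr //; apply: ext_bilin_scale.
Qed.

Fact ext_scaleA a b v : ext_scale a (ext_scale b v) = ext_scale (a * b) v.
Proof.
rewrite -(fsum_repr v) !ext_fsumZ /ext_fscale -map_comp; congr fsum.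
by apply: eq_map => p /=; rewrite mulrA.
Qed.
Fact ext_scale1 : left_id 1 ext_scale.
Proof.
move=> v; rewrite -(fsum_repr v) ext_fsumZ; congr fsum.
by rewrite -[RHS]map_id; apply: eq_map => -[m a] /=; rewrite mul1r.
Qed.
Fact ext_scaleDr : right_distributive ext_scale +%R.
Proof.
move=> a u v; rewrite -(fsum_repr u) -(fsum_repr v).
by rewrite -fsum_cat !ext_fsumZ /ext_fscale map_cat fsum_cat.
Qed.
Fact ext_scaleDl v : {morph ext_scale^~ v : a b / a + b}.
Proof.
move=> a b; rewrite -(fsum_repr v) !ext_fsumZ -fsum_cat.
apply/fsumP => V f fB; rewrite eval_cat !ext_eval_scale -big_split.
apply: eq_bigr => p _ /=.
have := fB.1 p.1 1 ((a * (p.2 : A) : A) : restr phi) ((b * (p.2 : A) : A) : restr phi).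
by rewrite !scale1r => <-; congr f; apply: mulrDl.
Qed.
HB.instance Definition _ := GRing.Zmodule_isLmodule.Build A (ext phi M)
  ext_scaleA ext_scale1 ext_scaleDr ext_scaleDl.

Lemma ext_scale_fsum (a : A) (s : seq (M * restr phi)) :
  a *: (fsum s : ext phi M) =
  fsum [seq (p.1, (a * (p.2 : A) : A) : restr phi) | p <- s].
Proof. exact: ext_fsumZ. Qed.

Definition ext_pure (m : M) (a : A) : ext phi M := pure m (a : restr phi).

Lemma ext_scaleE a m b : a *: ext_pure m b = ext_pure m (a * b).
Proof. exact: ext_fsumZ. Qed.

End Ext.

(* The map [id (x) h] from [ext phi M] to [ext (h \o phi) M]. *)
Section ExtMap.
Variables (R A B : comPzRingType) (phi : {rmorphism R -> A}).
Variables (h : {rmorphism A -> B}) (M : lmodType R).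

Definition ext_map_fmap (s : seq (M * restr phi)) : seq (M * restr (h \o phi)) :=
  [seq (p.1, (h p.2 : B) : restr (h \o phi)) | p <- s].

Definition ext_map (x : ext phi M) : ext (h \o phi) M :=
  fsum (ext_map_fmap (repr (x : tensor M (restr phi)))).

Lemma ext_map_fsum (s : seq (M * restr phi)) :
  ext_map (fsum s) = fsum (ext_map_fmap s).
Proof.
apply/fsumP => V f fB.
have gB : bilinear_map (fun m (a : restr phi) =>
    f m ((h a : B) : restr (h \o phi))).
  split=> [m r b b'|b]; last exact: fB.2.
  rewrite -fB.1; congr f.
  by rewrite [LHS]rmorphD !restr_scaleE rmorphM.
have := eval_repr s gB; rewrite /fsum_eval !big_map; exact.
Qed.

Lemma ext_map0 : ext_map 0 = 0.
Proof. exact: (ext_map_fsum [::]). Qed.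

Lemma ext_mapP a (u v : ext phi M) :
  ext_map (a *: u + v) = h a *: ext_map u + ext_map v.
Proof.
rewrite -(fsum_repr u) -(fsum_repr v) ext_scale_fsum -fsum_cat !ext_map_fsum.
rewrite ext_scale_fsum /ext_map_fmap map_cat fsum_cat -!map_comp.
congr (fsum _ + _); apply: eq_map => p /=.
by rewrite rmorphM.
Qed.

End ExtMap.

Definition tensor_ring (k B C : comPzRingType) (beta : {rmorphism k -> B})
  (gamma : {rmorphism k -> C}) : Type := tensor (restr beta) (restr gamma).

Section TensorRing.
Variables (k B C : comPzRingType).
Variables (beta : {rmorphism k -> B}) (gamma : {rmorphism k -> C}).
Local Notation M := (restr beta).
Local Notation N := (restr gamma).
Local Notation T := (tensor_ring beta gamma).

HB.instance Definition _ := GRing.Zmodule.copy T (tensor M N).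

Definition tring_fmul (s t : seq (M * N)) : seq (M * N) :=
  [seq (p.1 * q.1, p.2 * q.2) | p <- s, q <- t].

Definition tring_one : T := pure (1 : M) (1 : N).
Definition tring_mul (x y : T) : T :=
  fsum (tring_fmul (repr (x : tensor M N)) (repr (y : tensor M N))).

Fact tring_eval_mul (V : lmodType k) (f : M -> N -> V) s t :
  fsum_eval f (tring_fmul s t) =
  fsum_eval (fun (b : M) (c : N) => fsum_eval (fun (b' : M) (c' : N) => f (b * b') (c * c')) t) s.
Proof. by rewrite /fsum_eval big_allpairs_dep. Qed.

Fact tring_eval_mulr (V : lmodType k) (f : M -> N -> V) s t :
  fsum_eval f (tring_fmul s t) =
  fsum_eval (fun (b' : M) (c' : N) => fsum_eval (fun (b : M) (c : N) => f (b * b') (c * c')) s) t.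
Proof. by rewrite tring_eval_mul [LHS]exchange_big. Qed.

Fact tring_scaleAr (R A : comPzRingType) (phi : {rmorphism R -> A})
  (r : R) (a b : restr phi) : a * (r *: b) = r *: (a * b).
Proof. exact: mulrCA. Qed.

Fact tring_bilin_l (V : lmodType k) (f : M -> N -> V) b c :
  bilinear_map f -> bilinear_map (fun (b' : M) (c' : N) => f (b * b') (c * c')).
Proof.
by move=> [f1 f2]; split=> x r y z; rewrite -?f1 -?f2 mulrDr tring_scaleAr.
Qed.

Fact tring_bilin_sum (V : lmodType k) (F : M * N -> M -> N -> V) s :
  (forall p, bilinear_map (F p)) ->
  bilinear_map (fun (b : M) (c : N) => \sum_(p <- s) F p b c).
Proof.
move=> FB; split=> x r y z /=; rewrite scaler_sumr -big_split.
  by apply: eq_bigr => p _; apply: (FB p).1.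
by apply: eq_bigr => p _; apply: (FB p).2.
Qed.

Fact tring_bilin_r (V : lmodType k) (f : M -> N -> V) t :
  bilinear_map f ->
  bilinear_map (fun (b : M) (c : N) => fsum_eval (fun (b' : M) (c' : N) => f (b * b') (c * c')) t).
Proof.
move=> fB; apply: (tring_bilin_sum (F := fun (p : M * N) (b : M) (c : N) => f (b * p.1) (c * p.2))) => p.
have [f1 f2] := tring_bilin_l p.1 p.2 fB; split=> x r y z.
  by have := f1 x r y z; rewrite !(mulrC p.1) !(mulrC p.2).
by have := f2 x r y z; rewrite !(mulrC p.1) !(mulrC p.2).
Qed.

Fact tring_fsumM s t : tring_mul (fsum s) (fsum t) = fsum (tring_fmul s t).
Proof.
apply/fsumP => V f fB; rewrite tring_eval_mul eval_repr; last exact: tring_bilin_r.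
rewrite -tring_eval_mul !tring_eval_mulr eval_repr //.
apply: (tring_bilin_sum (F := fun (p : M * N) (b : M) (c : N) => f (p.1 * b) (p.2 * c))) => p.
exact: tring_bilin_l.
Qed.

Fact tring_mulA : associative tring_mul.
Proof.
move=> x y z; rewrite -(fsum_repr x) -(fsum_repr y) -(fsum_repr z) !tring_fsumM.
apply/fsumP => V f fB; rewrite !tring_eval_mul.
apply: eq_bigr => p _; rewrite tring_eval_mul; apply: eq_bigr => q _.
by apply: eq_bigr => r _; rewrite !mulrA.
Qed.
Fact tring_mulC : commutative tring_mul.
Proof.
move=> x y; rewrite -(fsum_repr x) -(fsum_repr y) !tring_fsumM.
apply/fsumP => V f fB; rewrite tring_eval_mul tring_eval_mulr; apply: eq_bigr => p _.
by apply: eq_bigr => q _; rewrite (mulrC q.1) (mulrC q.2).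
Qed.
Fact tring_mul1 : left_id tring_one tring_mul.
Proof.
move=> x; rewrite -(fsum_repr x) tring_fsumM; apply/fsumP => V f fB.
rewrite tring_eval_mul /fsum_eval big_seq1; apply: eq_bigr => p _.
by rewrite !mul1r.
Qed.
Fact tring_mulDl : left_distributive tring_mul +%R.
Proof.
move=> x y z; rewrite -(fsum_repr x) -(fsum_repr y) -(fsum_repr z).
rewrite -fsum_cat !tring_fsumM -fsum_cat; apply/fsumP => V f fB.
by rewrite tring_eval_mul !eval_cat !tring_eval_mul.
Qed.
HB.instance Definition _ := GRing.Zmodule_isComPzRing.Build T
  tring_mulA tring_mulC tring_mul1 tring_mulDl.

Definition tens (b : B) (c : C) : T := pure (b : M) (c : N).

Lemma tensM b c b' c' : tens b c * tens b' c' = tens (b * b') (c * c').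
Proof. exact: tring_fsumM. Qed.

Definition tensl (b : B) : T := tens b 1.
Definition tensr (c : C) : T := tens 1 c.

Fact tensl_zmod : zmod_morphism tensl.
Proof.
move=> x y.
have -> : tensl x - tensl y =
    fsum ([:: (x : M, 1 : N)] ++ fsum_opp [:: (y : M, 1 : N)]).
  by rewrite fsum_cat fsum_oppE.
apply/fsumP => V f fB; rewrite eval_cat /fsum_eval !big_seq1 /=.
by have := fB.2 1 1 x (- (y : M)); rewrite !scale1r.
Qed.
Fact tensl_monoid : monoid_morphism tensl.
Proof. by split=> // x y; rewrite /tensl tensM mulr1. Qed.
HB.instance Definition _ := GRing.isZmodMorphism.Build B T tensl tensl_zmod.
HB.instance Definition _ := GRing.isMonoidMorphism.Build B T tensl tensl_monoid.

End TensorRing.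

(* The inverse limit of the [T/(S)^N]: sequences of representatives, up to
   sequences whose [N]-th term is in [(S)^N]. *)
Section Completion.
Variables (T : comPzRingType) (S : set T).

Definition coherent : {pred (nat -> T)} :=
  fun x => `[< forall N, ideal_pow S N (x N.+1 - x N) >].

Fact coherent_subring : subring_closed coherent.
Proof.
split.
- by apply/asboolP => N; rewrite subrr; apply: ideal_gen0.
- move=> x y /asboolP xS /asboolP yS; apply/asboolP => N /=.
  have -> : (x - y) N.+1 - (x - y) N = (x N.+1 - x N) - (y N.+1 - y N).
    by rewrite !fctE /= opprD addrACA -[- y N.+1 - _]opprD.
  exact: ideal_genD (xS N) (ideal_genN (yS N)).
- move=> x y /asboolP xS /asboolP yS; apply/asboolP => N /=.
  have -> : (x * y) N.+1 - (x * y) N =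
      x N.+1 * (y N.+1 - y N) + y N * (x N.+1 - x N).
    by rewrite !mulrBr addrA [y N * _]mulrC subrK [y N * _]mulrC.
  exact: ideal_genD (ideal_genM _ (yS N)) (ideal_genM _ (xS N)).
Qed.
HB.instance Definition _ :=
  GRing.isSubringClosed.Build (nat -> T) coherent coherent_subring.

Record coherent_seq := CoherentSeq
  { coherent_val :> nat -> T; _ : coherent_val \in coherent }.
HB.instance Definition _ := [isSub for coherent_val].
HB.instance Definition _ := [Choice of coherent_seq by <:].
HB.instance Definition _ := GRing.SubChoice_isSubComPzRing.Build _ coherent coherent_seq coherent_subring.

Definition null_seq : set coherent_seq :=
  [set x | forall N, ideal_pow S N (x N)].

Definition completion := quot_ring null_seq.
HB.instance Definition _ := GRing.ComPzRing.on completion.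

Fact const_coherent (t : T) : (fun _ : nat => t) \in coherent.
Proof. by apply/asboolP => N; rewrite subrr; apply: ideal_gen0. Qed.

Definition const_seq (t : T) := CoherentSeq (const_coherent t).

Fact const_seq_zmod : zmod_morphism const_seq.
Proof. by move=> x y; apply: val_inj. Qed.
Fact const_seq_monoid : monoid_morphism const_seq.
Proof. by split=> [|x y]; apply: val_inj. Qed.
HB.instance Definition _ :=
  GRing.isZmodMorphism.Build T coherent_seq const_seq const_seq_zmod.
HB.instance Definition _ :=
  GRing.isMonoidMorphism.Build T coherent_seq const_seq const_seq_monoid.

Definition to_completion : T -> completion := @quot_proj _ null_seq \o const_seq.
HB.instance Definition _ := GRing.RMorphism.on to_completion.

End Completion.

(* [R] is a [k]-algebra through [c], and a quotient of a power series ring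
   over [k] in [r] variables whose classes are the [x i]. *)
Section PrincipalParts.
Variables (k R : comPzRingType) (c : {rmorphism k -> R}).
Variables (r : nat) (x : 'I_r -> R).

Definition ctensor : Type :=
  completion [set t : tensor_ring c c |
    exists i, t = tensl c c (x i) \/ t = tensr c c (x i)].
HB.instance Definition _ := GRing.ComPzRing.on ctensor.

Definition ctensl : R -> ctensor := to_completion _ \o tensl c c.
Definition ctensr : R -> ctensor := to_completion _ \o tensr c c.
HB.instance Definition _ := GRing.RMorphism.on ctensl.

Definition diag_gen : set ctensor :=
  [set t | exists i, t = ctensl (x i) - ctensr (x i)].

Definition parts_ring (n : nat) : Type := quot_ring (ideal_pow diag_gen n.+1).
HB.instance Definition _ n := GRing.ComPzRing.on (parts_ring n).

Definition parts_str (n : nat) : R -> parts_ring n := @quot_proj _ _ \o ctensl.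
HB.instance Definition _ n := GRing.RMorphism.on (parts_str n).

Definition principal_parts (n : nat) : Type := restr (@parts_str n).
HB.instance Definition _ n := GRing.Lmodule.on (principal_parts n).

End PrincipalParts.

Definition prime_ideal (A : comPzRingType) (p : set A) : Prop :=
  [/\ ideal p, ~ p 1 & forall a b, p (a * b) -> p a \/ p b].

(* Sets of points of Spec A are sets of subsets of [A], of which only the
   prime members matter. *)
Definition spec_open (A : comPzRingType) (U : set (set A)) : Prop :=
  exists E : set A, forall p, prime_ideal p -> (U p <-> ~ (E `<=` p)).

Definition spec_dense (A : comPzRingType) (U : set (set A)) : Prop :=
  forall f, (exists p, prime_ideal p /\ ~ p f) ->
            exists p, [/\ prime_ideal p, U p & ~ p f].

(* [V_f] is free of rank [r] over [A_f]: after multiplication by a power of [f],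
   a basis can be taken in the image of [V]. *)
Definition free_at (A : comPzRingType) (V : lmodType A) (r : nat) (f : A) :=
  exists v : 'I_r -> V,
    (forall w, exists N (c : 'I_r -> A), f ^+ N *: w = \sum_(i < r) c i *: v i)
    /\ (forall c : 'I_r -> A, \sum_(i < r) c i *: v i = 0 ->
          exists N, forall i, f ^+ N * c i = 0).

Definition locally_free_on (A : comPzRingType) (V : lmodType A) (r : nat)
    (U : set (set A)) : Prop :=
  forall p, prime_ideal p -> U p -> exists f, ~ p f /\ free_at V r f.

(* Schemes are given by their functors of points on commutative rings. *)
Record functor := Functor {
  pts :> comPzRingType -> Type;
  act : forall A B : comPzRingType, {rmorphism A -> B} -> pts A -> pts B;
  act_id : forall A (x : pts A), act idfun x = x;
  act_comp : forall (A B C : comPzRingType) (g : {rmorphism B -> C}) (h : {rmorphism A -> B})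
      (x : pts A), act (g \o h) x = act g (act h x) }.

Definition part (F : functor) := forall A : comPzRingType, set (F A).

(* [Z] is a closed subfunctor of [G]: for each morphism from Spec A to [G], the
   inverse image of [Z] is the closed subscheme Spec A/I for some ideal [I]. *)
Definition closed_in (F : functor) (G Z : part F) : Prop :=
  (forall A, Z A `<=` G A) /\
  forall (A : comPzRingType) (x : F A), G A x ->
    exists I : set A, ideal I /\
      forall (B : comPzRingType) (h : {rmorphism A -> B}),
        Z B (act h x) <-> (forall a, I a -> h a = 0).

(* The smallest closed subscheme of [G] containing [V]. When [V] is a reduced
   open subscheme, this is its closure with the reduced structure. *)
Definition closure_in (F : functor) (G V : part F) : part F := fun A =>
  [set x | G A x /\
     forall Z : part F, closed_in G Z -> (forall B, V B `<=` Z B) -> Z A x].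

Definition spec_act (R A B : comPzRingType) (h : {rmorphism A -> B})
  (phi : {rmorphism R -> A}) : {rmorphism R -> B} := h \o phi.

Definition Spec (R : comPzRingType) : functor.
Proof.
apply: (@Functor (fun A => {rmorphism R -> A}) (@spec_act R)).
- by move=> A x; apply: rmorph_ext.
- by move=> A B C g h x; apply: rmorph_ext.
Defined.

Section Nash.
Variables (R : comPzRingType) (M : lmodType R).

(* An [A]-point of Spec R together with a quotient of the pullback of [M] to
   Spec A, represented by its kernel. *)
Record quot_point (A : comPzRingType) := QuotPoint {
  str : {rmorphism R -> A};
  ker : set (ext str M);
  ker_submodule : submodule ker }.

Lemma quot_point_eq (A : comPzRingType) (x y : quot_point A) :
  str x = str y ->
  (forall s : seq (M * A),
     ker (fsum (s : seq (M * restr (str x)))) <->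
     ker (fsum (s : seq (M * restr (str y))))) ->
  x = y.
Proof.
case: x y => [f K HK] [g L HL] /= E; move: K HK; rewrite {f}E => K HK KL.
suff E : K = L by move: HK; rewrite E => HK; rewrite (Prop_irrelevance HK HL).
by apply/seteqP; split=> t; rewrite -(fsum_repr t) => /KL.
Qed.

(* Base change: the kernel of the pullback of a quotient is generated by the
   image of its kernel. *)
Definition quot_act (A B : comPzRingType) (h : {rmorphism A -> B})
    (x : quot_point A) : quot_point B :=
  @QuotPoint B (spec_act h (str x)) (span [set ext_map h t | t in @ker A x])
    (span_submodule _).

Fact quot_act_aux (A B : comPzRingType) (f : {rmorphism R -> A})
    (g g' : {rmorphism R -> B}) (u : ext f M -> ext g M)
    (v : ext f M -> ext g' M) (S : set (ext f M)) (s : seq (M * B)) :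
  g = g' ->
  (forall t : seq (M * restr f), exists t' : seq (M * B),
     u (fsum t) = fsum (t' : seq (M * restr g)) /\
     v (fsum t) = fsum (t' : seq (M * restr g'))) ->
  span [set u t | t in S] (fsum (s : seq (M * restr g))) <->
  span [set v t | t in S] (fsum (s : seq (M * restr g'))).
Proof.
move=> E; move: u v; rewrite E => u v uv.
suff -> : u = v by [].
apply/funext => t; rewrite -(fsum_repr t).
by have [t' [-> ->]] := uv (repr (t : tensor M (restr f))).
Qed.

Fact quot_act_id (A : comPzRingType) (x : quot_point A) : quot_act idfun x = x.
Proof.
have E : spec_act idfun (str x) = str x by apply: rmorph_ext.
apply: (@quot_point_eq _ (quot_act _ _) _ E) => s /=.
rewrite (@quot_act_aux _ _ _ _ _ _ id _ _ E) => [|t].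
  rewrite image_id; split; last exact: span_sub.
  exact: (span_min (@ker_submodule _ x)).
exists t; split=> //; rewrite ext_map_fsum; congr fsum.
by rewrite -[RHS]map_id; apply: eq_map => -[].
Qed.

Fact quot_act_comp (A B C : comPzRingType) (g : {rmorphism B -> C})
    (h : {rmorphism A -> B}) (x : quot_point A) :
  quot_act (g \o h) x = quot_act g (quot_act h x).
Proof.
have E : spec_act (g \o h) (str x) = spec_act g (spec_act h (str x)).
  exact: rmorph_ext.
refine (@quot_point_eq _ (quot_act (g \o h) x) (quot_act g (quot_act h x)) E _) => s /=.
rewrite (@quot_act_aux _ _ _ _ _ _ (fun t : ext (str x) M => ext_map g (ext_map h t)) _ _ E) => [|t].
  set K := span [set ext_map h t | t in _].
  have [G0 GD] := span_submodule [set ext_map g t | t in K].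
  have KS : submodule K by apply: span_submodule.
  split; (apply: span_min; first exact: span_submodule).
    move=> _ [t Kt <-]; apply: span_sub; exists (ext_map h t) => //.
    by apply: span_sub; exists t.
  move=> _ [t Kt <-]; set G := (X in X (ext_map g t)).
  apply: (@span_min _ _ _ (fun t => G (ext_map g t)) _ _ _ Kt) => {t Kt}.
    have [G'0 G'D] : submodule G by exact: span_submodule.
    by split=> [|a u v Gu Gv]; rewrite ?ext_map0 ?ext_mapP //; apply: G'D.
  by move=> _ [t Kt <-]; apply: span_sub; exists t.
exists [seq (p.1, (g (h p.2) : C)) | p <- t]; split.
  by rewrite ext_map_fsum.
by rewrite /= !ext_map_fsum /ext_map_fmap -map_comp.
Qed.

Definition Quot : functor := Functor quot_act_id quot_act_comp.

Definition grass (r : nat) : part Quot := fun A =>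
  [set x | exists (Q : lmodType A) (q : {linear ext (str x) M -> Q}),
    [/\ forall y, exists t, q t = y,
        forall t, @ker A x t <-> q t = 0 &
        locally_free_on Q r [set: set A]]].

Definition grass_over (r : nat) (U : set (set R)) : part Quot := fun A =>
  [set x | grass r x /\ forall p, prime_ideal p -> U (str x @^-1` p)].

Definition nash (r : nat) (U : set (set R)) : part Quot :=
  closure_in (grass r) (grass_over r U).

(* The Nash blowup of [M] may be defined from any such [U], and does not depend
   on its choice. *)
Definition nash_open (r : nat) (U : set (set R)) : Prop :=
  [/\ spec_open U, spec_dense U & locally_free_on M r U].

(* [Z] is isomorphic to Spec R, as a scheme over Spec R: there are bijections
   [sigma A] from Spec R (A) to [Z A], natural in [A] and commuting with the
   projections [str] to Spec R. Injectivity follows from the latter. *)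
Definition iso_base (Z : part Quot) : Prop :=
  exists sigma : forall A, Spec R A -> Quot A,
    [/\ forall (A B : comPzRingType) (h : {rmorphism A -> B}) phi,
          sigma B (act h phi) = act h (sigma A phi),
        forall (A : comPzRingType) (phi : Spec R A), str (sigma A phi) = phi &
        forall (A : comPzRingType) (x : Quot A),
          Z A x <-> exists phi, x = sigma A phi].

End Nash.

Arguments nash [R] M r U A _.

(* The case of R = k[[x_1, ..., x_r]]/b of pure dimension [d]. *)
Section HigherNash.
Variables (k R : comPzRingType) (c : {rmorphism k -> R}).
Variables (r : nat) (x : 'I_r -> R) (d n : nat).

Definition higher_nash_open (U : set (set R)) : Prop :=
  nash_open (principal_parts c x n) 'C(n + d, d) U.

Definition higher_nash (U : set (set R)) : part (Quot (principal_parts c x n)) :=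
  nash (principal_parts c x n) 'C(n + d, d) U.

End HigherNash.

Arguments higher_nash [k R] c [r] x d n U A _.

(* [f : pseries k] is the power series with coefficients [f n]. *)
Definition pseries (k : comPzRingType) : Type := nat -> k.

Section Series.
Variable k : comPzRingType.
Implicit Types f g h : pseries k.

HB.instance Definition _ := GRing.Zmodule.copy (pseries k) (nat -> k).

Definition pseries_one : pseries k := fun n => (n == 0%N)%:R.
Definition pseries_mul f g : pseries k := fun n => \sum_(i < n.+1) f i * g (n - i)%N.

Fact pseries_mul_rev f g n : pseries_mul f g n = \sum_(i < n.+1) f (n - i)%N * g i.
Proof.
rewrite /pseries_mul (reindex_inj rev_ord_inj) /=.
by apply: eq_bigr => j _; rewrite (sub_ordK j).
Qed.

Fact pseries_mulA : associative pseries_mul.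
Proof.
move=> p q r; apply/funext => i; rewrite [RHS]pseries_mul_rev.
pose coef3 j l := p j * (q (i - j - l)%N * r l).
transitivity (\sum_(j < i.+1) \sum_(l < i.+1 | (l <= i - j)%N) coef3 j l).
  apply: eq_bigr => /= j _; rewrite pseries_mul_rev big_distrr /=.
  by rewrite (big_ord_narrow_leq (leq_subr _ _)).
rewrite (exchange_big_dep predT) //=; apply: eq_bigr => l _.
transitivity (\sum_(j < i.+1 | (j <= i - l)%N) coef3 j l).
  apply: eq_bigl => j; rewrite -ltnS -(ltnS j) -!subSn ?leq_ord //.
  by rewrite -subn_gt0 -(subn_gt0 j) -!subnDA addnC.
rewrite (big_ord_narrow_leq (leq_subr _ _)) /pseries_mul big_distrl /=.
by apply: eq_bigr => j _; rewrite /coef3 -!subnDA addnC mulrA.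
Qed.
Fact pseries_mulC : commutative pseries_mul.
Proof.
move=> f g; apply/funext => n; rewrite pseries_mul_rev; apply: eq_bigr => i _.
exact: mulrC.
Qed.
Fact pseries_mul1 : left_id pseries_one pseries_mul.
Proof.
move=> f; apply/funext => n; rewrite /pseries_mul big_ord_recl subn0 mul1r.
by rewrite big1 ?addr0 // => i _; rewrite mul0r.
Qed.
Fact pseries_mulDl : left_distributive pseries_mul +%R.
Proof.
move=> f g h; apply/funext => n; rewrite [RHS](_ : _ = pseries_mul f h n + pseries_mul g h n) // -big_split.
by apply: eq_bigr => i _; apply: mulrDl.
Qed.
HB.instance Definition _ := GRing.Zmodule_isComPzRing.Build (pseries k)
  pseries_mulA pseries_mulC pseries_mul1 pseries_mulDl.

Lemma pseriesM f g n : (f * g) n = \sum_(i < n.+1) f i * g (n - i)%N.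
Proof. by []. Qed.

(* The series obtained by substituting x^2 for y and x^3 for z in the power
   series in y and z with coefficients [c i j]. *)
Definition subst23 (c : nat -> nat -> k) : pseries k := fun n =>
  \sum_(i < n.+1) \sum_(j < n.+1 | (2 * i + 3 * j)%N == n) c i j.

Definition cusp_pred : {pred pseries k} :=
  fun f => `[< exists c : nat -> nat -> k, f = subst23 c >].

Lemma cusp_predP f : reflect (f 1%N = 0) (f \in cusp_pred).
Proof.
apply: (iffP (asboolP _)) => [[g ->]|f1].
  rewrite /subst23 big1 // => i _; rewrite big1 // => j /eqP.
  by case: i j => [[|[|i]] ?] [[|[|j]] ?].
exists (fun i j => if j == odd (2 * i + 3 * j)%N :> nat
                   then f (2 * i + 3 * j)%N else 0).
apply/funext => n; rewrite /subst23 pair_big_dep /=.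
have [->|n1] := eqVneq n 1%N.
  by rewrite f1 big1 // => -[i j] /= /eqP ij; exfalso; lia.
have E : (2 * ((n - 3 * odd n) %/ 2) + 3 * odd n)%N = n by lia.
have li : ((n - 3 * odd n) %/ 2 < n.+1)%N by lia.
have lj : (odd n < n.+1)%N by lia.
rewrite (bigD1 (Ordinal li, Ordinal lj)) /= ?E // eqxx big1 ?addr0 //.
move=> [i j] /= /andP[/eqP Eij]; rewrite Eij -pair_eqE /pair_eq /=.
rewrite -!val_eqE /= => ne; case: eqP => // Ej; exfalso; move: ne.
by rewrite Ej eqxx andbT => /eqP; apply; lia.
Qed.

Fact cusp_subring : subring_closed cusp_pred.
Proof.
split.
- exact/cusp_predP.
- move=> f g /cusp_predP f1 /cusp_predP g1; apply/cusp_predP.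
  by rewrite [LHS](_ : _ = f 1%N - g 1%N) // f1 g1 subrr.
- move=> f g /cusp_predP f1 /cusp_predP g1; apply/cusp_predP.
  by rewrite pseriesM !big_ord_recl big_ord0 /= f1 g1 mulr0 mul0r !addr0.
Qed.

Record cusp := Cusp { cusp_val :> pseries k; _ : cusp_val \in cusp_pred }.
HB.instance Definition _ := [isSub for cusp_val].
HB.instance Definition _ := [Choice of cusp by <:].
HB.instance Definition _ :=
  GRing.SubChoice_isSubComPzRing.Build _ cusp_pred cusp cusp_subring.

Definition monomial (m : nat) : pseries k := fun n => (n == m)%:R.

Fact cusp_coord_subproof (i : 'I_2) : monomial (i + 2) \in cusp_pred.
Proof. by apply/cusp_predP; case: i => [[|[]]]. Qed.

Definition cusp_coord (i : 'I_2) : cusp := Cusp (cusp_coord_subproof i).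

Definition pconst (a : k) : pseries k := fun n => a *+ (n == 0%N).

Fact cusp_const_subproof (a : k) : pconst a \in cusp_pred.
Proof. exact/cusp_predP. Qed.

Definition cusp_const (a : k) : cusp := Cusp (cusp_const_subproof a).

Fact cusp_const_zmod : zmod_morphism cusp_const.
Proof. by move=> a b; apply/val_inj/funext => n; apply: mulrnBl. Qed.
Fact cusp_const_monoid : monoid_morphism cusp_const.
Proof.
split=> [|a b]; apply/val_inj/funext => n //=.
rewrite [RHS]pseriesM big_ord_recl subn0 /pconst mulr1n big1 ?addr0.
  by rewrite mulrnAr.
by move=> i _; rewrite mulr0n mul0r.
Qed.
HB.instance Definition _ :=
  GRing.isZmodMorphism.Build k cusp cusp_const cusp_const_zmod.
HB.instance Definition _ :=
  GRing.isMonoidMorphism.Build k cusp cusp_const cusp_const_monoid.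

End Series.

(* Main.v *)
Require Import Defs.
From HB Require Import structures.
From mathcomp Require Import all_boot all_order all_algebra.
From mathcomp Require Import boolp classical_sets.
From mathcomp Require Import ring zify.

Set Implicit Arguments.
Unset Strict Implicit.
Unset Printing Implicit Defensive.

Import GRing.Theory.
Local Open Scope ring_scope.
Local Open Scope classical_set_scope.

(** Let R = k[[x^2, x^3]] and let M be its module of principal parts of order n.
    Two facts give the result: in characteristic 2 or 3 the module M is free of
    rank n + 1 modulo its torsion, and the Nash blowup of a module over a domain
    which is free modulo torsion is the base itself.

    For the first fact, write U and V for the differences 1 (x) x^i - x^i (x) 1
    with i = 2 and i = 3. Substituting x + t for the second variable sends U to
    2 x t + t^2 and V to 3 x^2 t + 3 x t^2 + t^3. In characteristic 2 the orders
    in t are 2 and 1, in characteristic 3 they are 1 and 3; let P be the element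
    of order p > 1 among the two and W the one of order 1. Every element of the
    completed tensor product is r (x) 1 + U u + V v ([ctensor_decomp]), and the
    equation of the cusp, which in small characteristic becomes
    V^2 = U (U^2 + x^2 U + x^4) or U^3 = V (V + 2 x^3), improves this to an
    expansion in the elements e_j = P^(j / p) W^(j mod p) with coefficients in R
    ([stair_expansion]). The order of e_j in t is exactly j, so that e_0, ..., e_n
    are linearly independent in M ([stair_indep]); and up to a power of x^2 the
    element e_j lies in the j-th power of the diagonal ideal, so that the e_j with
    j > n are torsion in M ([stair_sat], [stair_gen]).

    For the second fact, let M be a module over a domain R which is free of rank
    r modulo torsion. Its quotient by the torsion is a section [canon] of the
    Grassmannian over Spec R. The image of this section is closed, being cut out
    by the coordinates of the elements of the kernel ([canon_part_closed]). It
    contains every point over an open set on which M is locally free of rank r: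
    there the torsion dies, and a surjection between locally free modules of the
    same rank is injective ([grass_over_canon]). Conversely a closed subscheme
    containing the points over that open set contains the generic point of the
    section, hence the whole section because R embeds in its fraction field
    ([nash_canon]). So the closure is the section. *)

(** * Submodules and ideals *)

Section SubmoduleTheory.
Variables (A : pzRingType) (V : lmodType A) (K : set V).
Hypothesis HK : submodule K.

Lemma submod0 : K 0. Proof. exact: HK.1. Qed.

Lemma submodZ a v : K v -> K (a *: v).
Proof. by move=> Kv; rewrite -[_ *: _]addr0; apply: HK.2 submod0. Qed.

Lemma submodD u v : K u -> K v -> K (u + v).
Proof. by move=> Ku Kv; rewrite -[u]scale1r; apply: HK.2. Qed.

Lemma submodN v : K v -> K (- v).
Proof. by move=> Kv; rewrite -scaleN1r; apply: submodZ. Qed.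

Lemma submodB u v : K u -> K v -> K (u - v).
Proof. by move=> Ku Kv; apply: submodD => //; apply: submodN. Qed.

Lemma submod_sum (I : Type) (s : seq I) (F : I -> V) :
  (forall i, K (F i)) -> K (\sum_(i <- s) F i).
Proof.
move=> KF; elim/big_rec: _ => [|i x _ Kx]; first exact: submod0.
exact: submodD.
Qed.

End SubmoduleTheory.

Lemma submodule_zero (A : pzRingType) (V : lmodType A) : submodule [set 0 : V].
Proof. by split=> [|a u v /= -> ->]; rewrite //= scaler0 addr0. Qed.

Section IdealTheory.
Variable A : comPzRingType.
Implicit Types I J : set A.

Lemma idealP I :
  I 0 -> (forall x y, I x -> I y -> I (x + y)) -> (forall a x, I x -> I (a * x)) ->
  ideal I.
Proof. by move=> I0 ID IM; split=> // a u v Iu Iv; apply: ID => //; apply: IM. Qed.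

Section Closure.
Variable I : set A.
Hypothesis HI : ideal I.

Lemma ideal0 : I 0. Proof. exact: (submod0 (V := A^o) HI). Qed.
Lemma idealD x y : I x -> I y -> I (x + y).
Proof. exact: (submodD (V := A^o) HI). Qed.
Lemma idealB x y : I x -> I y -> I (x - y).
Proof. exact: (submodB (V := A^o) HI). Qed.
Lemma idealN x : I x -> I (- x).
Proof. exact: (submodN (V := A^o) HI). Qed.
Lemma ideal_mull a x : I x -> I (a * x).
Proof. exact: (submodZ (V := A^o) HI). Qed.
Lemma ideal_mulr a x : I x -> I (x * a).
Proof. by rewrite mulrC; apply: ideal_mull. Qed.
Lemma ideal_sum (T : Type) (s : seq T) (F : T -> A) :
  (forall i, I (F i)) -> I (\sum_(i <- s) F i).
Proof. exact: (submod_sum (V := A^o) HI). Qed.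

End Closure.

Lemma prime_exp (p : set A) (f : A) N : prime_ideal p -> p (f ^+ N) -> p f.
Proof.
move=> [_ p1 pM]; elim: N => [|N IH]; first by rewrite expr0 => /p1.
by rewrite exprS => /pM[].
Qed.

(** Zorn's lemma is applied to the sets whose union with [J] is a proper ideal,
    rather than to the ideals containing [J], so that the empty chain is no
    exception. *)
Lemma exists_prime (J : set A) : ideal J -> ~ J 1 ->
  exists p, prime_ideal p /\ J `<=` p.
Proof.
move=> HJ J1.
pose P X := ideal (J `|` X) /\ ~ (J `|` X) 1.
have [F FP Ftot|X [[HX X1] Xmax]] := @Zorn_bigcup A P.
  split; last by move=> [//|[X FX X1]]; apply: (FP _ FX).2; right.
  apply: idealP; first by left; apply: ideal0.
    move=> x y [Jx|[X FX Xx]] [Jy|[Y FY Yy]].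
    + by left; apply: idealD.
    + have: (J `|` Y) (x + y) by apply: (idealD (FP _ FY).1); [left|right].
      by case=> ?; [left|right; exists Y].
    + have: (J `|` X) (x + y) by apply: (idealD (FP _ FX).1); [right|left].
      by case=> ?; [left|right; exists X].
    + have [XY|YX] := Ftot _ _ FX FY.
        have: (J `|` Y) (x + y) by apply: (idealD (FP _ FY).1); right => //; apply: XY.
        by case=> ?; [left|right; exists Y].
      have: (J `|` X) (x + y) by apply: (idealD (FP _ FX).1); right => //; apply: YX.
      by case=> ?; [left|right; exists X].
  move=> a x [Jx|[X FX Xx]]; first by left; apply: ideal_mull.
  have: (J `|` X) (a * x) by apply: (ideal_mull (FP _ FX).1); right.
  by case=> ?; [left|right; exists X].
exists (J `|` X); split; last by left.
split=> // a b Xab; have [?|na] := EM ((J `|` X) a); first by left.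
right; have [//|nb] := EM ((J `|` X) b); exfalso.
(* Maximality makes [p + (a)] contain 1 as soon as [a] is not in [p]. *)
have unitmax c : ~ (J `|` X) c -> exists y d, (J `|` X) y /\ y + d * c = 1.
  move=> nc; pose Y := [set z | exists y d, (J `|` X) y /\ y + d * c = z].
  have XY : J `|` X `<=` Y by move=> y Xy; exists y, 0; rewrite mul0r addr0.
  have Yc : Y c by exists 0, 1; rewrite add0r mul1r; split=> //; apply: ideal0.
  have YE : J `|` Y = Y by apply/setUidPr => y Jy; apply: XY; left.
  have [//|Y1] := EM (Y 1); exfalso; apply: (Xmax Y).
    split; first by move=> y Xy; apply: XY; right.
    by move=> YX; apply: nc; right; apply: YX.
  split; rewrite YE //; apply: idealP.
  - by apply: XY; apply: ideal0.
  - move=> _ _ [y [d [Xy <-]]] [y' [d' [Xy' <-]]]; exists (y + y'), (d + d').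
    by split; [apply: idealD|rewrite mulrDl addrACA].
  - move=> u _ [y [d [Xy <-]]]; exists (u * y), (u * d).
    by split; [apply: ideal_mull|rewrite mulrDr mulrA].
have [y [d [Xy E]]] := unitmax a na; have [y' [d' [Xy' E']]] := unitmax b nb.
apply: X1; rewrite -[1]mulr1 -{1}E -E'.
have -> : (y + d * a) * (y' + d' * b) =
  (y' + d' * b) * y + (d * a * y' + d * d' * (a * b)) by ring.
by repeat apply: (idealD HX); apply: (ideal_mull HX).
Qed.

(** A proper ideal lies in some prime, which cannot contain the given [f ^+ N].
    This replaces partitions of unity in the local arguments below. *)
Lemma local_unit (J : set A) : ideal J ->
  (forall p, prime_ideal p -> exists f N, ~ p f /\ J (f ^+ N)) -> J 1.
Proof.
move=> HJ loc; have [//|J1] := EM (J 1).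
have [p [pP Jp]] := exists_prime HJ J1; have [f [N [nf Jf]]] := loc p pP.
by exfalso; apply: nf; apply: (prime_exp pP (N := N)); apply: Jp.
Qed.

(** Membership is local: the multipliers of [w] into [K] form an ideal. *)
Lemma local_submod (V : lmodType A) (K : set V) (w : V) : submodule K ->
  (forall p, prime_ideal p -> exists f N, ~ p f /\ K (f ^+ N *: w)) -> K w.
Proof.
move=> HK loc; rewrite -[w]scale1r.
apply: (@local_unit [set a | K (a *: w)] _ loc); apply: idealP.
- by rewrite /= scale0r; apply: submod0.
- by move=> x y Kx Ky; rewrite /= scalerDl; apply: submodD.
- by move=> a x Kx; rewrite /= -scalerA; apply: submodZ.
Qed.

End IdealTheory.

Lemma prime_preimage (A B : comPzRingType) (h : {rmorphism B -> A}) (p : set A) :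
  prime_ideal p -> prime_ideal (h @^-1` p).
Proof.
move=> [Ip p1 pM]; split=> [||a b]; last by rewrite /preimage /= rmorphM => /pM.
  apply: idealP => [|x y|a x]; rewrite /preimage /= ?rmorph0 ?rmorphD ?rmorphM.
  - exact: ideal0.
  - exact: idealD.
  - exact: ideal_mull.
by rewrite /preimage /= rmorph1.
Qed.

(** * The fraction field of a domain *)

Definition is_domain (R : comPzRingType) : Prop :=
  (1 : R) <> 0 /\ forall a b : R, a * b = 0 -> a = 0 \/ b = 0.

Section Domain.
Variable R : comPzRingType.
Hypothesis dom : is_domain R.

Lemma domain_mulI (a b : R) : a <> 0 -> a * b = 0 -> b = 0.
Proof. by move=> a0 /dom.2[]. Qed.

Lemma domain_expI (a b : R) N : a <> 0 -> a ^+ N * b = 0 -> b = 0.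
Proof.
move=> a0; elim: N => [|N IH]; first by rewrite mul1r.
by rewrite exprS -mulrA => /(domain_mulI a0).
Qed.

Lemma domain_prime0 : prime_ideal [set 0 : R].
Proof.
split=> [||a b /dom.2//]; last exact: dom.1.
apply: idealP => //= [x y -> ->|a x ->]; [exact: addr0|exact: mulr0].
Qed.

(** A copy of [R] which depends on the proof that [R] is a domain, so that the
    structures of integral domain can be attached to it. *)
Definition domain_type (_ : is_domain R) : Type := R.

Local Notation D := (domain_type dom).
HB.instance Definition _ := GRing.ComPzRing.copy D R.

Fact domain_oner_neq0 : (1 : D) != 0. Proof. exact/eqP/dom.1. Qed.
HB.instance Definition _ := GRing.PzSemiRing_isNonZero.Build D domain_oner_neq0.

Definition domain_unit : {pred D} := fun x => `[< exists y, y * x = 1 >].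
Definition domain_inv (x : D) : D :=
  if pselect (exists y, y * x = 1) is left h then projT1 (cid h) else x.

Fact domain_mulVx : {in domain_unit, left_inverse 1 domain_inv *%R}.
Proof.
move=> x /asboolP xU; rewrite /domain_inv; case: pselect => // h.
exact: projT2 (cid h).
Qed.
Fact domain_unitPl (x y : D) : y * x = 1 -> domain_unit x.
Proof. by move=> xy; apply/asboolP; exists y. Qed.
Fact domain_inv_out : {in [predC domain_unit], domain_inv =1 id}.
Proof. by move=> x /asboolP xU; rewrite /domain_inv; case: pselect. Qed.
HB.instance Definition _ := GRing.ComNzRing_hasMulInverse.Build D
  domain_mulVx domain_unitPl domain_inv_out.

Fact domain_integral : GRing.integral_domain_axiom D.
Proof. by move=> x y /dom.2[] ->; rewrite eqxx ?orbT. Qed.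
HB.instance Definition _ := GRing.ComUnitRing_isIntegral.Build D domain_integral.

Lemma domain_embeds_in_field :
  exists (F : fieldType) (h : {rmorphism R -> F}), forall a, h a = 0 -> a = 0.
Proof.
exists {fraction D}, (@tofrac D : {rmorphism D -> {fraction D}}) => a /eqP.
by rewrite tofrac_eq0 => /eqP.
Qed.

End Domain.

Lemma field_prime (F : fieldType) (p : set F) : prime_ideal p -> p = [set 0].
Proof.
move=> [pI p1 _]; apply/seteqP; split=> [a pa|_ ->]; last exact: ideal0.
have [//|a0] := eqVneq a 0; exfalso; apply: p1.
by rewrite -(mulVf a0); apply: ideal_mull.
Qed.

(** * Extension of scalars *)

Section ExtTheory.
Variables (R A : comPzRingType) (phi : {rmorphism R -> A}) (M : lmodType R).
Implicit Types (m : M) (a : A).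

Lemma ext_pureP (r : R) m m' a :
  ext_pure phi (r *: m + m') a = phi r *: ext_pure phi m a + ext_pure phi m' a.
Proof.
rewrite ext_scaleE.
transitivity (fsum ([:: (m, (phi r * a) : restr phi)] ++ [:: (m', a : restr phi)]) : ext phi M).
  apply/fsumP => V f fB; rewrite eval_cat /fsum_eval !big_seq1 /= fB.2.
  congr (_ + _); have := fB.1 m r a 0.
  have f0 : f m 0 = 0.
    apply: (addrI (f m 0)); rewrite addr0 -{3}[0](addr0 (0 : restr phi)) -{3}(scale1r 0).
    by rewrite fB.1 scale1r.
  by rewrite f0 !addr0 => <-.
exact: fsum_cat.
Qed.

Lemma ext_pure1 m a : ext_pure phi m a = a *: ext_pure phi m 1.
Proof. by rewrite ext_scaleE mulr1. Qed.

Lemma ext_fsumE (s : seq (M * A)) :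
  fsum (s : seq (M * restr phi)) = \sum_(p <- s) p.2 *: ext_pure phi p.1 1 :> ext phi M.
Proof.
elim: s => [|[m a] s IH]; first by rewrite big_nil.
by rewrite big_cons /= -ext_pure1 -IH -[_ :: s]cat1s; apply: fsum_cat.
Qed.

Lemma ext_ind (P : ext phi M -> Prop) : P 0 ->
  (forall u v, P u -> P v -> P (u + v)) -> (forall m a, P (a *: ext_pure phi m 1)) ->
  forall t, P t.
Proof.
move=> P0 PD Pp t; rewrite -(fsum_repr t).
have -> := ext_fsumE (repr (t : tensor M (restr phi))).
by elim/big_rec: _ => // p u _ Pu; apply: PD.
Qed.

Lemma ext_pureZ (r : R) m : ext_pure phi (r *: m) 1 = phi r *: ext_pure phi m 1.
Proof.
have := ext_pureP r m 0 1; rewrite addr0 => ->.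
suff -> : ext_pure phi (0 : M) 1 = 0 by rewrite addr0.
apply: (addIr (ext_pure phi 0 1)); rewrite add0r.
by have := ext_pureP 1 0 0 1; rewrite scaler0 addr0 rmorph1 scale1r.
Qed.

Lemma ext_pureD m m' : ext_pure phi (m + m') 1 = ext_pure phi m 1 + ext_pure phi m' 1.
Proof. by have := ext_pureP 1 m m' 1; rewrite scale1r rmorph1 scale1r. Qed.

Lemma ext_pure_sum (I : Type) (s : seq I) (F : I -> M) :
  ext_pure phi (\sum_(i <- s) F i) 1 = \sum_(i <- s) ext_pure phi (F i) 1.
Proof.
elim: s => [|i s IH]; last by rewrite !big_cons ext_pureD IH.
by rewrite !big_nil; have := ext_pureZ 0 0; rewrite scaler0 rmorph0 scale0r.
Qed.

End ExtTheory.

Section ExtMapTheory.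
Variables (R A B : comPzRingType) (phi : {rmorphism R -> A}).
Variables (h : {rmorphism A -> B}) (M : lmodType R).

Lemma ext_map_pure (m : M) : ext_map h (ext_pure phi m 1) = ext_pure (h \o phi) m 1.
Proof.
have := ext_map_fsum h [:: (m, 1 : restr phi)]; rewrite /ext_map_fmap /= rmorph1.
exact.
Qed.

Lemma ext_mapD (u v : ext phi M) : ext_map h (u + v) = ext_map h u + ext_map h v.
Proof. by have := ext_mapP h 1 u v; rewrite rmorph1 !scale1r. Qed.

Lemma ext_mapZ a (u : ext phi M) : ext_map h (a *: u) = h a *: ext_map h u.
Proof. by have := ext_mapP h a u 0; rewrite ext_map0 !addr0. Qed.

Lemma ext_map_sum (I : Type) (s : seq I) (F : I -> ext phi M) :
  ext_map h (\sum_(i <- s) F i) = \sum_(i <- s) ext_map h (F i).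
Proof.
elim: s => [|i s IH]; last by rewrite !big_cons ext_mapD IH.
by rewrite !big_nil ext_map0.
Qed.

End ExtMapTheory.

(** * Nash blowups of modules which are free modulo torsion *)

(** Multiplying by the adjugate of [D] shows that [\det D] kills [c], and
    [\det C * \det D] is a power of [a]. This form of the statement that a
    surjection between free modules of the same rank is injective is stable
    under localization at [a]. *)
Lemma mulmx_scalar_inj (A : comPzRingType) r (C D : 'M[A]_r) (a : A) (c : 'rV[A]_r) :
  C *m D = a%:M -> c *m D = 0 -> a ^+ r *: c = 0.
Proof.
move=> CD cD; rewrite -det_scalar -CD det_mulmx -scalerA.
suff -> : \det D *: c = 0 by rewrite scaler0.
by rewrite -mul_mx_scalar -mul_mx_adj mulmxA cD mul0mx.
Qed.

Lemma free_at_family (A : comPzRingType) (V : lmodType A) r f (I : finType)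
    (v : 'I_r -> V) (w : I -> V) :
  (forall w, exists N (c : 'I_r -> A), f ^+ N *: w = \sum_(i < r) c i *: v i) ->
  exists N (C : I -> 'I_r -> A), forall j, f ^+ N *: w j = \sum_(i < r) C j i *: v i.
Proof.
move=> gen; have /choice[n0 /choice[c0 E]] := fun j => gen (w j).
exists (\sum_j n0 j)%N, (fun j i => f ^+ (\sum_(l | l != j) n0 l) * c0 j i) => j.
rewrite (bigD1 j) //= addnC exprD -scalerA E scaler_sumr.
by apply: eq_bigr => i _; rewrite scalerA.
Qed.

Lemma exp_family (I : finType) (P : I -> nat -> Prop) :
  (forall i n m, (n <= m)%N -> P i n -> P i m) -> (forall i, exists n, P i n) ->
  exists n, forall i, P i n.
Proof.
move=> Pmon /choice[n0 E]; exists (\sum_j n0 j)%N => i; apply: Pmon (E i).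
by rewrite (bigD1 i) //= leq_addr.
Qed.

(** The elements [e] form a basis of [M] modulo the torsion killed by powers of
    [tau]. *)
Section FreeModTorsion.
Variables (R : comPzRingType) (M : lmodType R) (r : nat).
Variables (e : 'I_r -> M) (tau : R).
Hypothesis dom : is_domain R.
Hypothesis tau0 : tau <> 0.
Hypothesis e_indep : forall c : 'I_r -> R, \sum_i c i *: e i = 0 -> forall i, c i = 0.
Hypothesis e_gen : forall m, exists (c : 'I_r -> R) N,
  tau ^+ N *: (m - \sum_i c i *: e i) = 0.

Definition coord (m : M) : 'I_r -> R := projT1 (cid (e_gen m)).

Lemma coordP m : exists N, tau ^+ N *: (m - \sum_i coord m i *: e i) = 0.
Proof. exact: projT2 (cid (e_gen m)). Qed.

Lemma coord_uniq m (c : 'I_r -> R) N :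
  tau ^+ N *: (m - \sum_i c i *: e i) = 0 -> coord m = c.
Proof.
move=> E; have [N' E'] := coordP m; apply/funext => i.
apply/eqP; rewrite -subr_eq0; apply/eqP.
apply: (domain_expI dom (a := tau) (N := N + N')) => //; move: i.
apply: e_indep.
transitivity (tau ^+ N' *: (tau ^+ N *: (m - \sum_i c i *: e i)) -
              tau ^+ N *: (tau ^+ N' *: (m - \sum_i coord m i *: e i))).
  rewrite !scalerA [tau ^+ N' * _]mulrC -exprD -scalerBr opprB addrC addrA subrK.
  by rewrite -sumrB scaler_sumr; apply: eq_bigr => i _; rewrite -scalerBl scalerA.
by rewrite E E' !scaler0 subrr.
Qed.

Lemma coord_lin a m m' i : coord (a *: m + m') i = a * coord m i + coord m' i.
Proof.
have [N E] := coordP m; have [N' E'] := coordP m'.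
rewrite (@coord_uniq _ (fun i => a * coord m i + coord m' i) (N + N')) //.
transitivity (a *: (tau ^+ N' *: (tau ^+ N *: (m - \sum_i coord m i *: e i))) +
              tau ^+ N *: (tau ^+ N' *: (m' - \sum_i coord m' i *: e i))); last first.
  by rewrite E E' !scaler0 addr0.
rewrite !scalerA [tau ^+ N' * _]mulrC -exprD [a * _]mulrC -scalerA -scalerDr.
congr (_ *: _); rewrite scalerBr addrACA -opprD scaler_sumr -big_split.
by congr (_ - _); apply: eq_bigr => j _; rewrite scalerDl scalerA.
Qed.

Lemma coord_e j i : coord (e j) i = (i == j)%:R.
Proof.
rewrite (@coord_uniq _ (fun i => (i == j)%:R) 0) // (bigD1 j) //= eqxx scale1r mulr1n scale1r.
by rewrite big1 ?addr0 ?subrr ?scaler0 // => l /negPf->; rewrite scale0r.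
Qed.

Lemma coord0 i : coord 0 i = 0.
Proof.
rewrite (@coord_uniq _ (fun=> 0) 0) // big1 ?subrr ?scaler0 // => j _.
by rewrite scale0r.
Qed.

Lemma coord_tors a m : a <> 0 -> a *: m = 0 -> forall i, coord m i = 0.
Proof.
move=> a0 am i; apply: (domain_mulI dom a0).
by have := coord_lin a m 0 i; rewrite am coord0 addr0 coord0 addr0.
Qed.

Lemma coord_eq0 m : (forall i, coord m i = 0) -> exists N, tau ^+ N *: m = 0.
Proof.
move=> m0; have [N E] := coordP m; exists N; rewrite -[RHS]E big1 ?subr0 //.
by move=> i _; rewrite m0 scale0r.
Qed.

Section Scalars.
Variables (A : comPzRingType) (phi : {rmorphism R -> A}).
Local Notation pureA m := (ext_pure phi m 1).

Definition proj_coord (t : ext phi M) (i : 'I_r) : A :=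
  fsum_eval (fun m (a : restr phi) => (phi (coord m i) * (a : A) : restr phi))
    (repr (t : tensor M (restr phi))).

(** The coordinates extended to [A]. *)
Definition proj t : 'rV[A]_r := \row_i proj_coord t i.

Fact proj_bilin i :
  bilinear_map (fun m (a : restr phi) => (phi (coord m i) * (a : A) : restr phi)).
Proof.
split=> [m|a] x y z; rewrite !restr_scaleE.
  by rewrite -[phi (coord m i) * (x *: y + z)]/(phi (coord m i) * (phi x * (y : A) + (z : A))) mulrDr mulrCA.
by rewrite coord_lin rmorphD rmorphM mulrDl -mulrA.
Qed.

Lemma proj_coord_fsum s i : proj_coord (fsum s) i = \sum_(p <- s) phi (coord p.1 i) * (p.2 : A).
Proof. exact: (eval_repr s (proj_bilin i)). Qed.

Lemma proj_lin : linear proj.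
Proof.
move=> a u v; apply/rowP => i; rewrite !mxE -(fsum_repr u) -(fsum_repr v).
rewrite ext_scale_fsum -fsum_cat !proj_coord_fsum big_cat big_map mulr_sumr.
by congr (_ + _); apply: eq_bigr => p _; rewrite mulrCA.
Qed.

HB.instance Definition _ := GRing.isLinear.Build A (ext phi M) 'rV[A]_r *:%R proj proj_lin.

Lemma proj0 : proj 0 = 0. Proof. exact: linear0. Qed.
Lemma projD u v : proj (u + v) = proj u + proj v. Proof. exact: linearD. Qed.
Lemma projZ a u : proj (a *: u) = a *: proj u. Proof. exact: linearZ. Qed.
Lemma proj_sum (I : Type) (s : seq I) (F : I -> ext phi M) :
  proj (\sum_(i <- s) F i) = \sum_(i <- s) proj (F i).
Proof. exact: linear_sum. Qed.

Lemma proj_pure m i : proj (pureA m) 0 i = phi (coord m i).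
Proof.
by rewrite mxE; have := proj_coord_fsum [:: (m, 1 : restr phi)] i; rewrite big_seq1 mulr1.
Qed.

Lemma proj_pure_e j : proj (pureA (e j)) = delta_mx 0 j.
Proof. by apply/rowP => i; rewrite proj_pure coord_e mxE eqxx rmorph_nat. Qed.

Definition tors_span : set (ext phi M) :=
  Defs.span [set pureA m | m in [set m | forall i, coord m i = 0]].

(** The coordinates split [M] into its torsion and the span of [e], and the
    splitting persists after extension of scalars. Hence the kernel of [proj] is
    generated by the torsion of [M], over every base. *)
Lemma proj_decomp t : tors_span (t - \sum_i proj t 0 i *: pureA (e i)).
Proof.
have HK : submodule tors_span by apply: span_submodule.
elim/ext_ind: t => [|u v Ku Kv|m a].
- rewrite proj0 big1 ?subr0; first exact: submod0.
  by move=> i _; rewrite mxE scale0r.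
- rewrite projD; set w := (X in tors_span X); suff -> : w =
    (u - \sum_i proj u 0 i *: pureA (e i)) + (v - \sum_i proj v 0 i *: pureA (e i)).
    exact: submodD.
  rewrite /w addrACA -opprD -big_split; congr (_ - _).
  by apply: eq_bigr => i _; rewrite [X in X *: _]mxE scalerDl.
- set w := (X in tors_span X); suff -> : w = a *: pureA (m - \sum_i coord m i *: e i).
    apply: submodZ => //; apply: span_sub; exists (m - \sum_i coord m i *: e i) => //.
    have [N E] := coordP m; apply: (coord_tors _ E) => tN0; apply: dom.1.
    by apply: (domain_expI dom tau0 (N := N)); rewrite tN0 mul0r.
  rewrite /w -scaleN1r ext_pureD ext_pureZ rmorphN1 scaleN1r scalerBr ext_pure_sum.
  congr (_ - _); rewrite scaler_sumr; apply: eq_bigr => i _.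
  by rewrite ext_pureZ projZ mxE scalerA proj_pure.
Qed.

Definition canon_ker : set (ext phi M) := [set t | proj t = 0].

Fact canon_ker_submodule : submodule canon_ker.
Proof.
split=> [|a u v]; rewrite /canon_ker /= ?proj0 // proj_lin => -> ->.
by rewrite scaler0 addr0.
Qed.

Lemma proj_eq0P t : proj t = 0 <-> tors_span t.
Proof.
split=> [t0|].
  by have := proj_decomp t; rewrite t0 big1 ?subr0 // => i _; rewrite mxE scale0r.
apply: (span_min canon_ker_submodule) => _ [m m0 <-].
by apply/rowP => i; rewrite proj_pure m0 rmorph0 mxE.
Qed.

(** The section of the Grassmannian given by [M] modulo torsion. *)
Definition canon : quot_point M A := QuotPoint canon_ker_submodule.

End Scalars.

Lemma proj_map (A B : comPzRingType) (h : {rmorphism A -> B}) (phi : {rmorphism R -> A})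
    (t : ext phi M) : proj (ext_map h t) = map_mx h (proj t).
Proof.
elim/ext_ind: t => [|u v Eu Ev|m a].
- by rewrite ext_map0 !proj0 map_mx0.
- by rewrite ext_mapD !projD map_mxD Eu Ev.
- rewrite ext_mapZ ext_map_pure !projZ map_mxZ; congr (_ *: _).
  by apply/rowP => i; rewrite proj_pure [RHS]mxE proj_pure.
Qed.

Lemma quot_point_ext (A : comPzRingType) (x : quot_point M A) :
  (forall t, @ker _ _ _ x t <-> proj t = 0) -> x = canon (str x).
Proof.
case: x => phi K HK /= KE; rewrite /canon.
have E : K = @canon_ker A phi by apply/seteqP; split=> t /KE.
by move: HK; rewrite E => HK; rewrite (Prop_irrelevance HK (canon_ker_submodule phi)).
Qed.

Lemma tors_span_map (A B : comPzRingType) (h : {rmorphism A -> B})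
    (phi : {rmorphism R -> A}) (t : ext (h \o phi) M) :
  tors_span t -> Defs.span [set ext_map h u | u in @canon_ker A phi] t.
Proof.
apply: span_min; first exact: span_submodule.
move=> _ [m m0 <-]; apply: span_sub; exists (ext_pure phi m 1); last exact: ext_map_pure.
by apply/rowP => i; rewrite proj_pure m0 rmorph0 mxE.
Qed.

Lemma canon_natural (A B : comPzRingType) (h : {rmorphism A -> B})
    (phi : {rmorphism R -> A}) : canon (h \o phi) = quot_act h (canon phi).
Proof.
apply/esym; apply: quot_point_ext => t; split=> [|/proj_eq0P]; last exact: tors_span_map.
apply: (span_min (canon_ker_submodule _)) => _ [u u0 <-].
by rewrite /canon_ker /= proj_map u0 map_mx0.
Qed.

Lemma canon_grass (A : comPzRingType) (phi : {rmorphism R -> A}) :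
  grass r (canon phi).
Proof.
exists 'rV[A]_r, (@proj A phi : {linear _ -> _}); split=> //.
  move=> y; exists (\sum_i y 0 i *: ext_pure phi (e i) 1).
  by rewrite /= proj_sum [RHS]row_sum_delta; apply: eq_bigr => i _; rewrite projZ proj_pure_e.
move=> p [_ p1 _] _; exists 1; split=> //; exists (fun i => delta_mx 0 i); split.
  by move=> w; exists 0%N, (fun i => w 0 i); rewrite scale1r {1}[w]row_sum_delta.
move=> c E; exists 0%N => i; rewrite mul1r; move/rowP/(_ i): E; rewrite mxE summxE (bigD1 i) //=.
rewrite !mxE !eqxx mulr1 big1 ?addr0 // => j ji.
by rewrite !mxE eqxx eq_sym (negPf ji) mulr0.
Qed.

(** Where the coordinates of the kernel of a quotient [Q] vanish, the quotient map
    followed by the coordinates is defined on [Q], and it is a surjection from a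
    module which locally has [r] generators to a free module of rank [r]. So it
    is injective, and the torsion already dies in [Q]. *)
Lemma ker_of_proj_kills (A B : comPzRingType) (h : {rmorphism A -> B})
    (x : quot_point M A) : grass r x ->
  (forall t i, @ker _ _ _ x t -> h (proj t 0 i) = 0) ->
  forall t, proj t = 0 -> Defs.span [set ext_map h u | u in @ker _ _ _ x] (ext_map h t).
Proof.
move=> [Q [q [qsurj kerq locfree]]] hI t t0.
apply: local_submod => [|P primeP]; first exact: span_submodule.
have [f [nf [v [gen _]]]] := locfree _ (prime_preimage h primeP) I.
have /choice[w wE] := fun i => qsurj (v i).
have [N [C CE]] := @free_at_family _ _ _ _ _ _ (fun j => q (ext_pure (str x) (e j) 1)) gen.
have [N' [c cE]] := gen (q t).
pose D : 'M[B]_r := \matrix_(i, l) h (proj (w i) 0 l).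
(* [D] holds the coordinates of the local generators [w i], and [C] expresses the
   elements [e j] through them up to the denominator [f ^+ N]. *)
have CD : (\matrix_(j, i) h (C j i)) *m D = (h f ^+ N)%:M.
  apply/matrixP => j l; rewrite !mxE.
  have /(hI _ l) : @ker _ _ _ x (f ^+ N *: ext_pure (str x) (e j) 1 - \sum_i C j i *: w i).
    apply/kerq; rewrite linearB linearZ /= CE linear_sum -sumrB big1 // => i _.
    by rewrite linearZ /= wE subrr.
  rewrite -scaleN1r addrC proj_lin projZ proj_pure_e proj_sum !mxE eqxx /= mulN1r.
  rewrite rmorphD rmorphN rmorphM rmorph_nat rmorphXn /= => /eqP.
  rewrite addrC subr_eq0 mulr_natr eq_sym (eq_sym l) => /eqP <-; rewrite summxE rmorph_sum.
  by apply: eq_bigr => i _; rewrite projZ !mxE rmorphM.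
have cD : (\row_i h (c i)) *m D = 0.
  apply/rowP => l; rewrite !mxE.
  have /(hI _ l) : @ker _ _ _ x (f ^+ N' *: t - \sum_i c i *: w i).
    apply/kerq; rewrite linearB linearZ /= cE linear_sum -sumrB big1 // => i _.
    by rewrite linearZ /= wE subrr.
  rewrite -scaleN1r addrC proj_lin projZ t0 scaler0 addr0 proj_sum !mxE mulN1r rmorphN.
  move=> /eqP; rewrite oppr_eq0 => /eqP E; rewrite -[RHS]E summxE rmorph_sum.
  by apply: eq_bigr => i _; rewrite projZ !mxE rmorphM.
have fc := mulmx_scalar_inj CD cD.
exists (h f), (N * r + N')%N; split=> //.
have -> : h f ^+ (N * r + N') *: ext_map h t =
    ext_map h (f ^+ (N * r) *: (f ^+ N' *: t - \sum_i c i *: w i)).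
  rewrite -rmorphXn -ext_mapZ exprD -scalerA -{1}[f ^+ N' *: t](subrK (\sum_i c i *: w i)).
  rewrite scalerDr ext_mapD [X in _ + X](_ : _ = 0) ?addr0 //.
  rewrite scaler_sumr ext_map_sum big1 // => i _; rewrite scalerA ext_mapZ.
  by have /rowP/(_ i) := fc; rewrite !mxE -exprM -rmorphXn -rmorphM => ->; rewrite scale0r.
apply: span_sub; exists (f ^+ (N * r) *: (f ^+ N' *: t - \sum_i c i *: w i)) => //.
apply/kerq; rewrite linearZ linearB linearZ /= cE linear_sum -sumrB big1 ?scaler0 // => i _.
by rewrite linearZ /= wE subrr.
Qed.

Definition canon_part : part (Quot M) := fun A =>
  [set x : quot_point M A | forall t, @ker _ _ _ x t <-> proj t = 0].

Lemma canon_part_grass A : @canon_part A `<=` @grass _ M r A.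
Proof. by move=> x /quot_point_ext->; apply: canon_grass. Qed.

(** The ideal is generated by the coordinates of the elements of the kernel: they
    vanish if the kernel is the canonical one, and [ker_of_proj_kills] gives the
    converse. *)
Lemma canon_part_closed : closed_in (@grass _ M r) canon_part.
Proof.
split=> [A|A x xG]; first exact: canon_part_grass.
pose S := [set a : A | exists t i, @ker _ _ _ x t /\ a = proj t 0 i].
exists (ideal_gen S); split=> [|B h]; first exact: ideal_gen_ideal.
split=> [xZ|hS].
  apply: (@span_min _ _ _ [set a : A^o | h a = 0]).
    split=> [|a u v /= u0 v0]; rewrite /= ?rmorph0 //.
    by rewrite rmorphD rmorphM u0 v0 mulr0 addr0.
  move=> _ [t [i [xt ->]]] /=.
  have /xZ : @ker _ _ _ (quot_act h x) (ext_map h t) by apply: span_sub; exists t.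
  by rewrite proj_map => /rowP/(_ i); rewrite !mxE.
have hI t i : @ker _ _ _ x t -> h (proj t 0 i) = 0.
  by move=> xt; apply: hS; apply: span_sub; exists t, i.
move=> t; split=> [|/proj_eq0P].
  apply: (span_min (canon_ker_submodule _)) => _ [u xu <-].
  by apply/rowP => i; rewrite proj_map [LHS]mxE [RHS]mxE; apply: hI.
have HK : submodule (@ker _ _ _ (quot_act h x)) by apply: ker_submodule.
apply: (span_min HK) => _ [m m0 <-]; rewrite -ext_map_pure.
by apply: ker_of_proj_kills => //; apply/rowP => i; rewrite proj_pure m0 rmorph0 mxE.
Qed.

Section Open.
Variable U : set (set R).
Hypothesis HU : nash_open M r U.

(** Locally on the open set [M] is free over a localization of the domain [R], so
    that the torsion of [M] vanishes there. *)
Lemma over_open_pure0 (A : comPzRingType) (phi : {rmorphism R -> A}) :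
  (forall p, prime_ideal p -> U (phi @^-1` p)) ->
  forall m, (forall i, coord m i = 0) -> ext_pure phi m 1 = 0.
Proof.
move=> phiU m m0; apply: (local_submod (@submodule_zero _ _)).
move=> p pP; have [_ _ Mfree] := HU.
have [g [ng [v [gen indep]]]] := Mfree _ (prime_preimage phi pP) (phiU p pP).
have [N [c cE]] := gen m; have [L mL] := coord_eq0 m0.
exists (phi g), N; split=> //=.
rewrite -rmorphXn -ext_pureZ cE big1 -?(scale0r m) ?ext_pureZ ?rmorph0 ?scale0r // => i _.
have g0 : g <> 0.
  move=> g0; apply: ng; rewrite g0 /preimage /= rmorph0.
  by case: pP => pI _ _; apply: ideal0.
suff -> : c i = 0 by rewrite scale0r.
have [N' cN] : exists N', forall i, g ^+ N' * (tau ^+ L * c i) = 0.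
  apply: indep; under eq_bigr do rewrite -scalerA.
  by rewrite -scaler_sumr -cE scalerA mulrC -scalerA mL scaler0.
by apply: (domain_expI dom tau0 (N := L)); apply: (domain_expI dom g0 (cN i)).
Qed.

(** Over the open set the pullback of [M] is free on [e], so that the kernel of a
    locally free quotient of the same rank vanishes. *)
Lemma grass_over_canon A : @grass_over _ M r U A `<=` @canon_part A.
Proof.
move=> x [[Q [q [qsurj kerq locfree]]] xU].
have tors0 (t : ext (str x) M) : proj t = 0 -> t = 0.
  move=> /proj_eq0P; apply: (span_min (@submodule_zero _ _)).
  by move=> _ [m m0 <-] /=; apply: (over_open_pure0 xU).
have decomp (t : ext (str x) M) : t = \sum_i proj t 0 i *: ext_pure (str x) (e i) 1.
  apply/eqP; rewrite -subr_eq0; apply/eqP/tors0; apply/rowP => l.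
  rewrite -scaleN1r addrC proj_lin proj_sum !mxE summxE (bigD1 l) //=.
  rewrite projZ proj_pure_e !mxE !eqxx mulr1 big1 ?addr0 ?mulN1r ?addNr // => i il.
  by rewrite projZ proj_pure_e !mxE eq_sym (negPf il) mulr0.
move=> t; split=> [|/tors0->]; last by apply: submod0; apply: ker_submodule.
move=> /kerq qt0; apply: (local_submod (@submodule_zero _ _)).
move=> p pP; have [f [nf [v [gen indep]]]] := locfree p pP I.
have /choice[w wE] := fun i => qsurj (v i).
have [N [C CE]] := @free_at_family _ _ _ _ _ _ (fun j => q (ext_pure (str x) (e j) 1)) gen.
have qE (u : ext (str x) M) : f ^+ N *: q u = \sum_i (proj u *m \matrix_(j, i) C j i) 0 i *: v i.
  rewrite {1}(decomp u) linear_sum scaler_sumr.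
  under eq_bigr => j _ do rewrite linearZ /= scalerA mulrC -scalerA CE scaler_sumr.
  rewrite exchange_big; apply: eq_bigr => i _; rewrite mxE scaler_suml.
  by apply: eq_bigr => j _; rewrite scalerA; congr (_ * _ *: _); rewrite mxE.
(* The local basis [v] and the images of the [e j] are expressed through each
   other by [D] and [C]; independence of [v] makes [D *m C] scalar, up to a power
   of [f]. *)
pose D : 'M[A]_r := \matrix_(i, l) proj (w i) 0 l.
have [N1 DC] : exists N1, D *m (f ^+ N1 *: \matrix_(j, i) C j i) = (f ^+ (N1 + N))%:M.
  have [N1 E] : exists n, forall i : 'I_r, forall j,
      f ^+ n * ((proj (w i) *m \matrix_(j, i) C j i) 0 j - f ^+ N * (i == j)%:R) = 0.
    apply: (@exp_family 'I_r) => [i n1 n2 n12 E j|i].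
      by rewrite -(subnK n12) exprD -mulrA E mulr0.
    apply: indep; under eq_bigr do rewrite scalerBl; rewrite sumrB -qE wE.
    rewrite (bigD1 i) //= eqxx mulr1 big1 ?addr0 ?subrr // => j /negPf.
    by rewrite eq_sym => ->; rewrite mulr0 scale0r.
  exists N1; apply/matrixP => i j; rewrite -scalemxAr mxE.
  have -> : (D *m \matrix_(j, i) C j i) i j = (proj (w i) *m \matrix_(j, i) C j i) 0 j.
    by rewrite !mxE; apply: eq_bigr => l _; rewrite mxE.
  have /eqP := E i j; rewrite mulrBr subr_eq0 => /eqP ->.
  by rewrite !mxE mulrA -exprD mulr_natr.
have [N2 tC] : exists N2, forall i, f ^+ N2 * (proj t *m \matrix_(j, i) C j i) 0 i = 0.
  by apply: indep; rewrite -qE qt0 scaler0.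
exists f, ((N1 + N) * r + N2)%N; split=> //=.
rewrite exprD -scalerA exprM; apply: (mulmx_scalar_inj DC).
rewrite -scalemxAl -scalemxAr scalerA mulrC -scalerA.
suff -> : f ^+ N2 *: (proj t *m \matrix_(j, i) C j i) = 0 by rewrite scaler0.
by apply/rowP => i; rewrite mxE tC mxE.
Qed.

(** A closed part containing the points over [U] meets the universal section over
    Spec R in Spec R/I. The fraction field of [R] gives a point of the section
    over [U], so [I] vanishes in that field, and the whole section is contained
    in the closed part. *)
Lemma nash_canon (A : comPzRingType) (phi : {rmorphism R -> A}) : nash M r U A (canon phi).
Proof.
split=> [|Z [ZG Zclosed] ZU]; first exact: canon_grass.
have [I [HI IE]] := Zclosed R (canon idfun) (canon_grass _).
have I0 a : I a -> a = 0.
  have [F [h hinj]] := domain_embeds_in_field dom.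
  move=> Ia; apply: (hinj); move: a Ia; apply/(IE F h); apply: ZU.
  rewrite -[act _ _]/(quot_act h (canon idfun)) -canon_natural.
  split; first exact: canon_grass.
  move=> p /[dup] pP /field_prime->.
  have -> : str (canon (h \o idfun)) @^-1` [set 0] = [set 0].
    by apply/seteqP; split=> a /= => [/hinj|->]; rewrite ?rmorph0.
  have [[E UE] Udense _] := HU.
  have P0 := domain_prime0 dom.
  have [|q [qP Uq _]] := Udense 1.
    by exists [set 0]; split=> //=; case: dom.
  apply/UE => // E0; apply: ((UE q qP).1 Uq) => a /E0 ->.
  by case: qP => qI _ _; apply: ideal0.
have -> : canon phi = quot_act phi (canon idfun).
  by rewrite -canon_natural; congr canon; apply: rmorph_ext.
by apply/IE => a /I0->; rewrite rmorph0.
Qed.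

Lemma nash_iso_base : iso_base (nash M r U).
Proof.
exists (fun A (phi : Spec R A) => canon phi); split=> //.
- by move=> A B h phi; apply: canon_natural.
- move=> A x; split=> [[xG xcl]|[phi ->]]; last exact: nash_canon.
  exists (str x); apply: quot_point_ext.
  by apply: (xcl canon_part canon_part_closed) => B; apply: grass_over_canon.
Qed.

End Open.

Lemma nash_open_exists : nash_open M r [set p | ~ p tau].
Proof.
split.
- by exists [set tau] => p _ /=; split=> [pt /(_ _ erefl)|pt tp] //; apply: pt => _ ->.
- move=> f [p [pP pf]]; exists [set 0]; split=> [|//|/= f0]; first exact: domain_prime0.
  by apply: pf; rewrite f0; case: pP => pI _ _; apply: ideal0.
- move=> p pP tp; exists tau; split=> //; exists e; split=> [m|c /e_indep c0].
    have [N E] := coordP m; exists N, (fun i => tau ^+ N * coord m i).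
    move/eqP: E; rewrite scalerBr subr_eq0 => /eqP->; rewrite scaler_sumr.
    by apply: eq_bigr => i _; rewrite scalerA.
  by exists 0%N => i; rewrite c0 mulr0.
Qed.

End FreeModTorsion.

(** * Power series *)

Section PowerSeries.
Variable K : comPzRingType.
Implicit Types f g : pseries K.

Lemma pseriesD f g n : (f + g) n = f n + g n. Proof. by []. Qed.
Lemma pseries_sum (I : Type) (s : seq I) (P : pred I) (F : I -> pseries K) n :
  (\sum_(i <- s | P i) F i) n = \sum_(i <- s | P i) F i n.
Proof. exact: (big_morph (fun f : pseries K => f n)). Qed.

Definition has_lead (j : nat) (a : K) f : Prop :=
  (forall i, (i < j)%N -> f i = 0) /\ f j = a.

Lemma has_leadM i j a b f g : has_lead i a f -> has_lead j b g ->
  has_lead (i + j) (a * b) (f * g).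
Proof.
move=> [f0 fi] [g0 gj]; split=> [n nij|]; rewrite pseriesM.
  rewrite big1 // => l _; have [/f0->|il] := ltnP l i; first by rewrite mul0r.
  by rewrite [g _]g0 ?mulr0 //; have := ltn_ord l; lia.
have iij : (i < (i + j).+1)%N by lia.
rewrite (bigD1 (Ordinal iij)) //= fi addKn gj big1 ?addr0 // => l.
rewrite -val_eqE /= => li; have [/f0->|il] := ltnP l i; first by rewrite mul0r.
by rewrite [g _]g0 ?mulr0 //; have := ltn_ord l; lia.
Qed.

Lemma has_lead1 : has_lead 0 1 1. Proof. by split. Qed.

Lemma has_leadX i a f n : has_lead i a f -> has_lead (i * n) (a ^+ n) (f ^+ n).
Proof.
move=> fi; elim: n => [|n IH]; first by rewrite muln0; apply: has_lead1.
by rewrite mulnS !exprS; apply: has_leadM.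
Qed.

Lemma has_lead_exists f : f <> 0 -> exists j a, a <> 0 /\ has_lead j a f.
Proof.
move=> f0; have fn : exists n, f n != 0.
  apply: contrapT => /forallNP fn; apply: f0; apply/funext => n.
  by have /negP := fn n; rewrite negbK => /eqP.
have [j fj jmin] := ex_minnP fn; exists j, (f j); split; first exact/eqP.
split=> // i ij; apply/eqP; apply: contraTT ij => fi.
by rewrite -leqNgt; apply: jmin.
Qed.

(** Lowest coefficients multiply. *)
Lemma pseries_domain : is_domain K -> is_domain (pseries K).
Proof.
move=> [K1 KM]; split=> [/(congr1 (fun f : pseries K => f 0%N))//|f g fg].
have [f0|/has_lead_exists[i [a [a0 fi]]]] := EM (f = 0); first by left.
have [g0|/has_lead_exists[j [b [b0 gj]]]] := EM (g = 0); first by right.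
have [_] := has_leadM fi gj; rewrite fg => /esym/KM; tauto.
Qed.

Lemma pconst_zmod : zmod_morphism (@pconst K).
Proof. by move=> a b; apply/funext => n; apply: mulrnBl. Qed.
Lemma pconst_monoid : monoid_morphism (@pconst K).
Proof.
split=> [|a b]; apply/funext => n //=.
rewrite [RHS]pseriesM big_ord_recl subn0 /pconst mulr1n big1 ?addr0.
  by rewrite mulrnAr.
by move=> i _; rewrite mulr0n mul0r.
Qed.
HB.instance Definition _ :=
  GRing.isZmodMorphism.Build K (pseries K) (@pconst K) pconst_zmod.
HB.instance Definition _ :=
  GRing.isMonoidMorphism.Build K (pseries K) (@pconst K) pconst_monoid.

Lemma pconstM a f n : (pconst a * f) n = a * f n.
Proof.
rewrite pseriesM big_ord_recl subn0 /pconst mulr1n big1 ?addr0 // => i _.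
by rewrite mulr0n mul0r.
Qed.

Lemma monomialM m f n : (monomial K m * f) n = if (m <= n)%N then f (n - m)%N else 0.
Proof.
rewrite pseriesM; case: leqP => mn.
  rewrite (bigD1 (Ordinal (mn : (m < n.+1)%N))) //= /monomial eqxx mul1r big1 ?addr0 //.
  by move=> i; rewrite -val_eqE /= => /negPf->; rewrite mul0r.
rewrite big1 // => i _; rewrite /monomial.
by case: eqP => [E|]; rewrite ?mul0r //; have := ltn_ord i; lia.
Qed.

(** The Taylor expansion f(x + t), a power series in t whose coefficients, the
    Hasse derivatives of f, are power series in x. *)
Definition taylor f : pseries (pseries K) := fun j m => f (m + j)%N *+ 'C(m + j, j).

Lemma taylor_const a : taylor (pconst a) = pconst (pconst a).
Proof.
apply/funext => -[|j]; apply/funext => m; rewrite /taylor /pconst.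
  by rewrite addn0 bin0 mulr1n.
by rewrite addnS /= mulr0n mul0rn.
Qed.

Fact taylor_zmod : zmod_morphism taylor.
Proof. by move=> f g; apply/funext => j; apply/funext => m; apply: mulrnBl. Qed.

(** Multiplicativity is Vandermonde's convolution. *)
Fact taylor_monoid : monoid_morphism taylor.
Proof.
split=> [|f g].
  have -> : (1 : pseries K) = pconst 1 by apply/funext => n.
  by rewrite taylor_const !rmorph1.
apply/funext => j; apply/funext => m; rewrite /taylor !pseriesM pseries_sum.
transitivity (\sum_(a < j.+1) \sum_(0 <= l < (m + j).+1)
    (f l *+ 'C(l, a)) * (g (m + j - l)%N *+ 'C(m + j - l, j - a))).
  rewrite -sumrMnl exchange_big /= big_mkord; apply: eq_bigr => l _.
  have /subnKC E : (l <= m + j)%N by have := ltn_ord l; lia.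
  rewrite -[in 'C(m + j, j)]E -(binomial.Vandermonde l (m + j - l) j) -sumrMnr.
  by apply: eq_bigr => a _; rewrite mulrnAl mulrnAr mulrnA mulrnAC.
apply: eq_bigr => a _; rewrite pseriesM.
have aj : (a <= j)%N by have := ltn_ord a; lia.
rewrite (@big_cat_nat _ _ _ a) //=; last by lia.
rewrite big_nat_cond big1 ?add0r; last first.
  by move=> l /andP[/andP[_ la] _]; rewrite bin_small // mulr0n mul0r.
rewrite (@big_cat_nat _ _ _ (a + m.+1)) //=; [|lia|lia].
rewrite [X in _ + X]big_nat_cond [X in _ + X]big1 ?addr0; last first.
  by move=> l /andP[/andP[l1 l2] _]; rewrite [X in _ * (_ *+ X)]bin_small ?mulr0n ?mulr0 //; lia.
rewrite -{1}[nat_of_ord a]add0n big_addn addKn big_mkord; apply: eq_bigr => b _.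
have bm : (b <= m)%N by have := ltn_ord b; lia.
by rewrite /taylor; have -> : (m + j - (b + a) = m - b + (j - a))%N by lia.
Qed.
HB.instance Definition _ :=
  GRing.isZmodMorphism.Build (pseries K) (pseries (pseries K)) taylor taylor_zmod.
HB.instance Definition _ :=
  GRing.isMonoidMorphism.Build (pseries K) (pseries (pseries K)) taylor taylor_monoid.

(** The filtration by total degree in x and t, for which the series in x and t
    are complete. *)
Definition deg_ge (N : nat) : set (pseries (pseries K)) :=
  [set w | forall j m, (j + m < N)%N -> w j m = 0].

Lemma deg_geM a b w w' : deg_ge a w -> deg_ge b w' -> deg_ge (a + b) (w * w').
Proof.
move=> wa wb j m jm; rewrite pseriesM pseries_sum big1 // => i _.
rewrite pseriesM big1 // => l _; have := ltn_ord i; have := ltn_ord l => lm ij.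
have [/wa->|il] := ltnP (i + l) a; first by rewrite mul0r.
by rewrite wb ?mulr0 //; lia.
Qed.

Lemma deg_ge_ideal N : ideal (deg_ge N).
Proof.
apply: idealP => [//|w w' wN wN' j m jm|w w' wN].
  by rewrite [LHS](_ : _ = w j m + w' j m) // wN // wN' // addr0.
by rewrite -[N]add0n; apply: deg_geM.
Qed.

End PowerSeries.

(** * Powers of an ideal *)

Section Powers.
Variable A : comPzRingType.
Implicit Types (S J : set A) (n : nat).

Lemma ideal_gen_min S J : ideal J -> S `<=` J -> ideal_gen S `<=` J.
Proof. exact: (@span_min A A^o). Qed.

Lemma ideal_pow_ideal S n : ideal (ideal_pow S n).
Proof. exact: ideal_gen_ideal. Qed.

Lemma ideal_pow_min S n J : ideal J ->
  (forall s : 'I_n -> A, (forall i, S (s i)) -> J (\prod_(i < n) s i)) ->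
  ideal_pow S n `<=` J.
Proof. by move=> HJ SJ; apply: ideal_gen_min => // _ [s [sS ->]]; apply: SJ. Qed.

Lemma ideal_pow0 S x : ideal_pow S 0 x.
Proof.
rewrite -[x]mulr1; apply: ideal_genM; apply: span_sub.
by exists (fun=> 0); split=> [[]//|]; rewrite big_ord0.
Qed.

Lemma ideal_powS S n s x : S s -> ideal_pow S n x -> ideal_pow S n.+1 (s * x).
Proof.
move=> Ss; apply: (@ideal_pow_min _ _ [set x | ideal_pow S n.+1 (s * x)]).
  have HI := ideal_pow_ideal S n.+1; apply: idealP => [|y z|a y] /=.
  - by rewrite mulr0; apply: ideal0.
  - by rewrite mulrDr; apply: idealD.
  - by rewrite mulrCA; apply: ideal_mull.
move=> t tS /=; apply: span_sub; exists (fun i => oapp t s (unlift ord0 i)); split.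
  by move=> i; case: unliftP => [j|] _ /=; [apply: tS|].
rewrite big_ord_recl unlift_none /=; congr (_ * _).
by apply: eq_bigr => i _; rewrite liftK.
Qed.

Lemma ideal_pow_pred S n s x : S s -> ideal_pow S n.-1 x -> ideal_pow S n (s * x).
Proof. by case: n => [|n] Ss Sx; [apply: ideal_pow0|apply: ideal_powS]. Qed.

Lemma ideal_pow1 S s : S s -> ideal_pow S 1 s.
Proof. by move=> Ss; rewrite -[s]mulr1; apply: ideal_powS => //; apply: ideal_pow0. Qed.

Lemma ideal_powM S n m x y :
  ideal_pow S n x -> ideal_pow S m y -> ideal_pow S (n + m) (x * y).
Proof.
move=> Sx Sy; move: x Sx; apply: (@ideal_pow_min _ _ [set x | ideal_pow S (n + m) (x * y)]).
  have HI := ideal_pow_ideal S (n + m); apply: idealP => [|x z|a x] /=.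
  - by rewrite mul0r; apply: ideal0.
  - by rewrite mulrDl; apply: idealD.
  - by rewrite -mulrA; apply: ideal_mull.
elim: n => [|n IH] s sS /=; first by rewrite big_ord0 mul1r.
by rewrite big_ord_recl -mulrA; apply: ideal_powS => //; apply: IH.
Qed.

Lemma ideal_powX S n m x : ideal_pow S n x -> ideal_pow S (n * m) (x ^+ m).
Proof.
move=> Sx; elim: m => [|m IH]; first by rewrite muln0; apply: ideal_pow0.
by rewrite mulnS exprS; apply: ideal_powM.
Qed.

Lemma ideal_pow_le S n m x : (m <= n)%N -> ideal_pow S n x -> ideal_pow S m x.
Proof.
move=> mn; apply: ideal_pow_min; first exact: ideal_pow_ideal.
elim: m n mn => [|m IH] [|n] // mn s sS; first exact: ideal_pow0.
  exact: ideal_pow0.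
by rewrite big_ord_recl; apply: ideal_powS => //; apply: IH.
Qed.

End Powers.

(** * Homomorphisms out of quotients, tensor products and completions *)

(* In the definitions of the lifts below, the hypothesis which makes them
   homomorphisms remains an argument, so that their structure of homomorphism
   can be inferred from the term. *)

Section QuotLift.
Variables (A W : comPzRingType) (S : set A) (f : {rmorphism A -> W}).
Hypothesis fS : forall x, S x -> f x = 0.

#[using="fS"] Definition quot_lift (x : quot_ring S) : W := f (repr x).

Lemma quot_liftE x : quot_lift (quot_proj S x) = f x.
Proof.
apply/eqP; rewrite -subr_eq0 -rmorphB; apply/eqP.
apply: (@ideal_gen_min _ S [set a | f a = 0]) (quot_reprP S x) => //.
apply: idealP => [|y z|a y] /=; first exact: rmorph0.
- by rewrite rmorphD => -> ->; rewrite addr0.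
- by rewrite rmorphM => ->; rewrite mulr0.
Qed.

Fact quot_lift_zmod : zmod_morphism quot_lift.
Proof.
move=> x y; rewrite (quot_projE x) (quot_projE y) -rmorphB !quot_liftE.
exact: rmorphB.
Qed.
Fact quot_lift_monoid : monoid_morphism quot_lift.
Proof.
split=> [|x y]; first by rewrite -(rmorph1 (quot_proj S)) quot_liftE rmorph1.
rewrite (quot_projE x) (quot_projE y) -rmorphM !quot_liftE.
exact: rmorphM.
Qed.
HB.instance Definition _ :=
  GRing.isZmodMorphism.Build (quot_ring S) W quot_lift quot_lift_zmod.
HB.instance Definition _ :=
  GRing.isMonoidMorphism.Build (quot_ring S) W quot_lift quot_lift_monoid.

End QuotLift.

Section TensorLift.
Variables (k B C W : comPzRingType).
Variables (beta : {rmorphism k -> B}) (gamma : {rmorphism k -> C}).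
Variables (f : {rmorphism B -> W}) (g : {rmorphism C -> W}).
Hypothesis fg : forall a, f (beta a) = g (gamma a).

Local Notation T := (tensor_ring beta gamma).
Local Notation F := (fun (b : restr beta) (c : restr gamma) =>
  f b * g c : restr (f \o beta)).

#[using="fg"] Definition tensor_lift (x : T) : W :=
  fsum_eval F (repr (x : tensor (restr beta) (restr gamma))).

Fact tensor_lift_bilin : bilinear_map F.
Proof.
split=> [b|c] x y z; rewrite !restr_scaleE /=.
  by rewrite rmorphD rmorphM mulrDr -fg mulrCA.
by rewrite rmorphD rmorphM mulrDl mulrA.
Qed.

Fact tensor_lift_fsum s : tensor_lift (fsum s) = \sum_(p <- s) f p.1 * g p.2.
Proof. exact: (eval_repr s tensor_lift_bilin). Qed.

Lemma tensor_liftE b c : tensor_lift (tens beta gamma b c) = f b * g c.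
Proof. by rewrite [LHS]tensor_lift_fsum big_seq1. Qed.

Fact tensor_lift_zmod : zmod_morphism tensor_lift.
Proof.
move=> x y; rewrite -(fsum_repr x) -(fsum_repr y).
rewrite -fsum_oppE -fsum_cat !tensor_lift_fsum big_cat big_map -sumrN.
by congr (_ + _); apply: eq_bigr => p _; rewrite /= rmorphN mulNr.
Qed.
Fact tensor_lift_monoid : monoid_morphism tensor_lift.
Proof.
split=> [|x y]; first by rewrite [LHS]tensor_liftE !rmorph1 mulr1.
rewrite -(fsum_repr x) -(fsum_repr y).
rewrite -[_ * _]/(tring_mul _ _) tring_fsumM !tensor_lift_fsum big_allpairs_dep.
rewrite mulr_suml; apply: eq_bigr => p _; rewrite mulr_sumr; apply: eq_bigr => q _.
by rewrite !rmorphM mulrACA.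
Qed.
HB.instance Definition _ :=
  GRing.isZmodMorphism.Build T W tensor_lift tensor_lift_zmod.
HB.instance Definition _ :=
  GRing.isMonoidMorphism.Build T W tensor_lift tensor_lift_monoid.

End TensorLift.

Lemma tensr_zmod (k B C : comPzRingType) (beta : {rmorphism k -> B})
  (gamma : {rmorphism k -> C}) : zmod_morphism (tensr beta gamma).
Proof.
move=> x y.
have -> : tensr beta gamma x - tensr beta gamma y =
    fsum ([:: (1 : restr beta, x : restr gamma)] ++
          fsum_opp [:: (1 : restr beta, y : restr gamma)]).
  by rewrite fsum_cat fsum_oppE.
apply/fsumP => V f fB; rewrite eval_cat eval_opp // /fsum_eval !big_seq1 /=.
have := fB.1 1 (-1) y x; rewrite !scaleN1r addrC => <-.
by rewrite addrC.
Qed.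

Fact tensr_monoid (k B C : comPzRingType) (beta : {rmorphism k -> B})
  (gamma : {rmorphism k -> C}) : monoid_morphism (tensr beta gamma).
Proof. by split=> // x y; rewrite /tensr tensM mulr1. Qed.
HB.instance Definition _ (k B C : comPzRingType) (beta : {rmorphism k -> B})
    (gamma : {rmorphism k -> C}) :=
  GRing.isZmodMorphism.Build C (tensor_ring beta gamma) (tensr beta gamma)
    (tensr_zmod beta gamma).
HB.instance Definition _ (k B C : comPzRingType) (beta : {rmorphism k -> B})
    (gamma : {rmorphism k -> C}) :=
  GRing.isMonoidMorphism.Build C (tensor_ring beta gamma) (tensr beta gamma)
    (tensr_monoid beta gamma).

Lemma tensr_scalar (k B C : comPzRingType) (beta : {rmorphism k -> B})
    (gamma : {rmorphism k -> C}) a :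
  tensr beta gamma (gamma a) = tensl beta gamma (beta a).
Proof.
apply/fsumP => V f [f1 f2]; rewrite /fsum_eval !big_seq1 /=.
have E1 := f1 1 a 1 0; have E2 := f2 1 a 1 0.
have f10 : f 1 0 = 0.
  apply: (addrI (f 1 0)); rewrite addr0 -{3}[0](addr0 (0 : restr gamma)) -{3}(scale1r 0).
  by rewrite f1 scale1r.
have f01 : f 0 1 = 0.
  apply: (addrI (f 0 1)); rewrite addr0 -{3}[0](addr0 (0 : restr beta)) -{3}(scale1r 0).
  by rewrite f2 scale1r.
move: E1 E2; rewrite f10 f01 !addr0 !restr_scaleE !mulr1 => -> /=.
by move=> ->.
Qed.

Lemma tens_mul (k B C : comPzRingType) (beta : {rmorphism k -> B})
    (gamma : {rmorphism k -> C}) b c :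
  tens beta gamma b c = tensl beta gamma b * tensr beta gamma c.
Proof. by rewrite tensM mulr1 mul1r. Qed.

HB.instance Definition _ (k R : comPzRingType) (c : {rmorphism k -> R})
  (r : nat) (x : 'I_r -> R) := GRing.RMorphism.on (ctensr c x).

(** A homomorphism to the series in x and t which sends the generators of the
    ideal to series without constant term is continuous, hence extends to the
    completion. *)
Section CompletionLift.
Variables (T K : comPzRingType) (S : set T).
Variable f : {rmorphism T -> pseries (pseries K)}.
Hypothesis fS : forall s, S s -> deg_ge 1 (f s).

Lemma map_pow_deg_ge N x : ideal_pow S N x -> deg_ge N (f x).
Proof.
apply: (@ideal_pow_min _ _ _ [set x | deg_ge N (f x)]).
  have HI := @deg_ge_ideal K N; apply: idealP => [|y z|a y] /=.
  - by rewrite rmorph0; apply: ideal0.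
  - by rewrite rmorphD; apply: idealD.
  - by rewrite rmorphM; apply: ideal_mull.
elim: N => [|N IH] s sS /=; first by move=> ? ?; rewrite ltn0.
rewrite big_ord_recl rmorphM; apply: (@deg_geM _ 1 N); first exact: fS.
exact: IH.
Qed.

(** The coefficient of x^m t^j only depends on the class modulo the power
    j + m + 1 of the ideal, hence can be read off there. *)
#[using="fS"] Definition lim_lift (z : coherent_seq S) : pseries (pseries K) :=
  fun j m => f (z (j + m).+1) j m.

Lemma lim_liftP (z : coherent_seq S) N : deg_ge N (f (z N) - lim_lift z).
Proof.
move=> j m jm; rewrite [LHS](_ : _ = f (z N) j m - f (z (j + m).+1) j m) //.
rewrite -(subnKC jm); elim: (N - _)%N => [|l IH]; first by rewrite addn0 subrr.
rewrite addnS -[X in X - _](subrK (f (z ((j + m).+1 + l)%N) j m)) -addrA IH addr0.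
have /asboolP/(_ ((j + m).+1 + l)%N) := valP z.
by move=> /map_pow_deg_ge; rewrite rmorphB; apply; lia.
Qed.

Lemma lim_lift_uniq (z : coherent_seq S) w :
  (forall N, deg_ge N (f (z N) - w)) -> lim_lift z = w.
Proof.
move=> zw; apply/funext => j; apply/funext => m; apply/eqP; rewrite -subr_eq0.
by rewrite -[_ - _]/((f (z (j + m).+1) - w) j m) zw.
Qed.

Fact lim_lift_zmod : zmod_morphism lim_lift.
Proof.
move=> y z; apply: lim_lift_uniq => N; rewrite rmorphB.
have -> : f (y N) - f (z N) - (lim_lift y - lim_lift z) =
  (f (y N) - lim_lift y) - (f (z N) - lim_lift z) by ring.
by apply: (idealB (@deg_ge_ideal K N)); apply: lim_liftP.
Qed.
Fact lim_lift_monoid : monoid_morphism lim_lift.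
Proof.
split=> [|y z]; apply: lim_lift_uniq => N.
  by rewrite rmorph1 subrr; apply: (ideal0 (@deg_ge_ideal K N)).
rewrite rmorphM.
have -> : f (y N) * f (z N) - lim_lift y * lim_lift z =
  f (z N) * (f (y N) - lim_lift y) + lim_lift y * (f (z N) - lim_lift z) by ring.
have HI := @deg_ge_ideal K N.
by apply: (idealD HI); apply: (ideal_mull HI); apply: lim_liftP.
Qed.
HB.instance Definition _ :=
  GRing.isZmodMorphism.Build (coherent_seq S) (pseries (pseries K)) lim_lift lim_lift_zmod.
HB.instance Definition _ :=
  GRing.isMonoidMorphism.Build (coherent_seq S) (pseries (pseries K)) lim_lift lim_lift_monoid.

Lemma lim_lift_null z : null_seq z -> lim_lift z = 0.
Proof. by move=> zn; apply: lim_lift_uniq => N; rewrite subr0; apply: map_pow_deg_ge. Qed.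

Definition completion_lift : completion S -> pseries (pseries K) :=
  quot_lift lim_lift_null.
HB.instance Definition _ := GRing.RMorphism.on completion_lift.

End CompletionLift.

(** * The cusp *)

Section Cusp.
Variable k : comPzRingType.
Local Notation R := (cusp k).
Local Notation cst := (@cusp_const k).
Local Notation x := (@cusp_coord k).

Lemma cusp_valD (f g : R) n : cusp_val (f + g) n = cusp_val f n + cusp_val g n. Proof. by []. Qed.
Lemma cusp_valB (f g : R) n : cusp_val (f - g) n = cusp_val f n - cusp_val g n. Proof. by []. Qed.
Lemma cusp_valM (f g : R) : cusp_val (f * g) = cusp_val f * cusp_val g. Proof. by []. Qed.
Lemma cusp_val_sum (I : Type) (s : seq I) (P : pred I) (F : I -> R) n :
  cusp_val (\sum_(i <- s | P i) F i) n = \sum_(i <- s | P i) cusp_val (F i) n.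
Proof. exact: (big_morph (fun f : R => cusp_val f n)). Qed.

Lemma cusp_val1 (f : R) : cusp_val f 1%N = 0.
Proof. exact/cusp_predP/(valP f). Qed.

Lemma cusp_val_inj : injective (@cusp_val k).
Proof. exact: val_inj. Qed.

Lemma cusp_domain : is_domain k -> is_domain R.
Proof.
move=> /pseries_domain[K1 KM]; split=> [/(congr1 (@cusp_val k))//|f g fg].
have /KM[] : cusp_val f * cusp_val g = 0 by rewrite -cusp_valM fg.
  by left; apply: cusp_val_inj.
by right; apply: cusp_val_inj.
Qed.

Definition order_ge (N : nat) (f : R) : Prop := forall m, (m < N)%N -> cusp_val f m = 0.

(** Division by x^2 of a series without constant term. The linear coefficient of
    the quotient, which comes from x^3, is dropped so as to stay in the cusp. *)
Fact cusp_div2_subproof (f : R) :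
  (fun m => if m == 1%N then 0 else cusp_val f (m + 2)%N) \in @cusp_pred k.
Proof. exact/cusp_predP. Qed.
Definition cusp_div2 f : R := Cusp (cusp_div2_subproof f).

Lemma cusp_div2E (f : R) : cusp_val f 0%N = 0 ->
  f = x ord0 * cusp_div2 f + x ord_max * cst (cusp_val f 3%N).
Proof.
move=> f0; apply/cusp_val_inj/funext => n; rewrite cusp_valD !cusp_valM !monomialM.
case: n => [|[|[|[|n]]]] /=; rewrite ?f0 ?cusp_val1 ?addr0 //.
- by rewrite add0r.
- by congr (cusp_val f _); lia.
Qed.

(** By induction on N, dividing by x^2: a term in x^3 is left over only when the
    order is less than 4, that is for the last factor. The homomorphism [h] is
    one of the two embeddings of [R] in the tensor product. *)
Lemma order_ge_pow (B : comPzRingType) (h : {rmorphism R -> B}) (S : set B) N f :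
  (forall i, S (h (x i))) -> order_ge N.*2 f -> ideal_pow S N (h f).
Proof.
move=> hS; elim: N f => [|N IH] f fN; first exact: ideal_pow0.
have f0 : cusp_val f 0%N = 0 by apply: fN.
have HI := ideal_pow_ideal S N.+1.
rewrite (cusp_div2E f0) rmorphD !rmorphM; apply: (idealD HI).
  apply: ideal_powS => //; apply: IH => m mN /=.
  by case: eqP => // _; apply: fN; rewrite doubleS; lia.
case: N {IH} fN HI => [_ HI|N fN HI].
  by apply: (ideal_mulr HI); apply: ideal_pow1.
by rewrite fN // !rmorph0 mulr0; apply: ideal0.
Qed.

(** Series in [R] whose terms have orders tending to infinity; each coefficient of
    the sum is a finite sum. *)
Section Sum.
Variable b : nat -> R.
Hypothesis bN : forall i, order_ge i.*2 (b i).

Fact cusp_series_subproof :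
  (fun m => \sum_(i < m.+1) cusp_val (b i) m) \in @cusp_pred k.
Proof. by apply/cusp_predP; rewrite big1 // => i _; apply: cusp_val1. Qed.
Definition cusp_series : R := Cusp cusp_series_subproof.

Lemma cusp_seriesE N : order_ge N.*2 (cusp_series - \sum_(i < N) b i).
Proof.
move=> m mN; rewrite cusp_valB cusp_val_sum /=.
have E n c : (m < n.*2)%N ->
    \sum_(i < n) cusp_val (b i) m = \sum_(i < n + c) cusp_val (b i) m.
  move=> mn; rewrite big_split_ord /= [X in _ + X]big1 ?addr0 // => i _.
  by apply: bN; rewrite doubleD; lia.
by rewrite (E m.+1 N) ?(E N m.+1) // 1?addnC ?subrr //; lia.
Qed.

End Sum.

Local Notation T := (tensor_ring cst cst).
Local Notation tl := (tensl cst cst).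
Local Notation tr := (tensr cst cst).
Local Notation S := [set t : T | exists i, t = tl (x i) \/ t = tr (x i)].
Local Notation D i := (tl (x i) - tr (x i)).

Lemma gen_l i : S (tl (x i)). Proof. by exists i; left. Qed.
Lemma gen_r i : S (tr (x i)). Proof. by exists i; right. Qed.

(** Constants can be moved to the first factor, and a series without constant
    term lies in the ideal of x^2 and x^3. *)
Lemma tensor_mod_gen (t : T) : exists (r : R) e, ideal_pow S 1 e /\ t = tl r + e.
Proof.
have HI := ideal_pow_ideal S 1.
suff E (s : seq (R * R)) : exists (r : R) e,
    ideal_pow S 1 e /\ fsum (s : seq (restr cst * restr cst)) = tl r + e.
  by rewrite -(fsum_repr t); apply: E.
elim: s => [|[b c] s [r [e [Se E]]]].
  by exists 0, 0; rewrite rmorph0 addr0; split=> //; apply: ideal0.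
have trE : tr c = tl (cst (cusp_val c 0%N)) + tr (c - cst (cusp_val c 0%N)).
  by rewrite -tensr_scalar -rmorphD addrC subrK.
exists (b * cst (cusp_val c 0%N) + r), (tl b * tr (c - cst (cusp_val c 0%N)) + e); split.
  apply: (idealD HI) => //; apply: (ideal_mull HI).
  apply: (order_ge_pow (N := 1)) gen_r _ => -[|[|]] // _; rewrite cusp_valB.
    by rewrite subrr.
  by rewrite !cusp_val1 subrr.
transitivity (tens cst cst b c + (fsum (s : seq (restr cst * restr cst)) : T)).
  exact: (fsum_cat [:: (b : restr cst, c : restr cst)] s).
rewrite E tens_mul trE [tl (_ + _)]rmorphD rmorphM mulrDr.
by rewrite addrACA.
Qed.

(** For N = 0 the truncated predecessor makes the condition on [g] void. *)
Definition decomposed N (b : R) (g : 'I_2 -> T) : Prop :=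
  order_ge N.*2 b /\ forall i, ideal_pow S N.-1 (g i).

(** Replace the factors 1 (x) x^i by x^i (x) 1 one at a time; each replacement
    costs a difference times a product of the other factors. *)
Lemma prod_decomp N (s : 'I_N -> T) : (forall i, S (s i)) ->
  exists b g, decomposed N b g /\ \prod_i s i = tl b + \sum_i D i * g i.
Proof.
elim: N s => [|N IH] s sS.
  exists 1, (fun=> 0); split; first by split=> // i; apply: ideal_pow0.
  by rewrite big_ord0 rmorph1 big1 ?addr0 // => i _; rewrite mulr0.
rewrite big_ord_recl; have [i Ei] := sS ord0.
have [b [g [[bN gN] E]]] := IH (fun i => s (lift ord0 i)) (fun i => sS _).
have PN : ideal_pow S N (\prod_(i < N) s (lift ord0 i)).
  by apply: span_sub; exists (fun i => s (lift ord0 i)).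
set P := \prod_(_ < _) _ in E PN *.
have xb : order_ge N.+1.*2 (x i * b).
  move=> m mN; rewrite cusp_valM monomialM; case: leqP => // im.
  by apply: bN; move: mN; rewrite doubleS; lia.
have xg j : ideal_pow S N (tl (x i) * g j).
  by apply: ideal_pow_pred (gN j); apply: gen_l.
have xE : tl (x i) * P = tl (x i * b) + \sum_j D j * (tl (x i) * g j).
  rewrite E mulrDr rmorphM mulr_sumr; congr (_ + _).
  by apply: eq_bigr => j _; rewrite mulrCA.
case: Ei => ->.
  by exists (x i * b), (fun j => tl (x i) * g j); split.
exists (x i * b), (fun j => tl (x i) * g j - (j == i)%:R * P); split.
  split=> // j; have HI := ideal_pow_ideal S N; apply: (idealB HI); first exact: xg.
  exact: (ideal_mull HI).
have -> : tr (x i) * P = tl (x i) * P - D i * P by ring.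
rewrite xE -addrA; congr (_ + _).
under [RHS]eq_bigr do rewrite mulrBr; rewrite sumrB; congr (_ - _).
by rewrite (bigD1 i) //= eqxx mul1r big1 ?addr0 // => j /negPf->; rewrite mul0r mulr0.
Qed.

(** One step of the approximation: up to the next power of the ideal, coefficients
    may be taken in the first factor. *)
Lemma pow_decomp N (d : T) : ideal_pow S N d -> exists b g e,
  [/\ decomposed N b g, ideal_pow S N.+1 e & d = tl b + \sum_i D i * g i + e].
Proof.
have HS n := ideal_pow_ideal S n.
move=> [m [c [s [sS ->]]]]; elim/big_rec: _ => [|j d' _ [b' [g' [e' [[bN' gN'] eN' ->]]]]].
  exists 0, (fun=> 0), 0; rewrite rmorph0 big1 ?addr0 => [|i _]; last by rewrite mulr0.
  by split=> //; [split=> // i|]; apply: ideal0.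
have [p [pS ->]] := sS j.
have [b [g [[bN gN] E]]] := prod_decomp pS.
have [r [e [Se ->]]] := tensor_mod_gen (c j).
exists (r * b + b'), (fun i => tl r * g i + g' i), (e * \prod_i p i + e'); split.
- split=> [n nN|i]; last by apply: (idealD (HS _)) => //; apply: (ideal_mull (HS _)).
  rewrite cusp_valD bN' // addr0 cusp_valM pseriesM big1 // => l _.
  by rewrite bN ?mulr0 //; have := ltn_ord l; lia.
- apply: (idealD (HS _)) => //; apply: (@ideal_powM _ _ 1 N) => //.
  by apply: span_sub; exists p.
have -> : \sum_i D i * (tl r * g i + g' i) =
    tl r * (\sum_i D i * g i) + \sum_i D i * g' i.
  by rewrite mulr_sumr -big_split; apply: eq_bigr => i _; rewrite mulrDr mulrCA.
rewrite -[_ *: _]/((tl r + e) * _) E rmorphD rmorphM; ring.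
Qed.

Local Notation C := (ctensor cst x).
Local Notation cl := (ctensl cst x).
Local Notation cr := (ctensr cst x).

(** The completed diagonal ideal is the kernel of the multiplication map. For an
    element given by a coherent sequence, [pow_decomp] is applied to successive
    remainders, which tend to 0, and the resulting corrections are summed: in the
    first factor as power series, in the cofactors as coherent sequences. *)
Theorem ctensor_decomp (z : C) : exists (r : R) (G : 'I_2 -> C),
  z = cl r + \sum_i (cl (x i) - cr (x i)) * G i.
Proof.
have HS n := ideal_pow_ideal S n.
rewrite (quot_projE z); set y := repr z.
have /choice[F FP] : forall Nd : nat * T, exists bge : R * ('I_2 -> T) * T,
    ideal_pow S Nd.1 Nd.2 -> [/\ decomposed Nd.1 bge.1.1 bge.1.2,
      ideal_pow S Nd.1.+1 bge.2 &
      Nd.2 = tl bge.1.1 + \sum_i D i * bge.1.2 i + bge.2].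
  move=> [N d]; have [/pow_decomp[b [g [e ?]]]|nd] := EM (ideal_pow S N d).
    by exists (b, g, e).
  by exists (0, fun=> 0, 0).
(* [rem N] is the part of [y N] not yet decomposed. *)
pose fix rem N : T := if N is N'.+1 then (F (N', rem N' + (y N'.+1 - y N'))).2 else y 0%N.
pose w N := rem N + (y N.+1 - y N).
pose b N := (F (N, w N)).1.1; pose g N := (F (N, w N)).1.2.
have yS N : ideal_pow S N (y N.+1 - y N) by have /asboolP := valP y; apply.
have remS N : ideal_pow S N (rem N).
  elim: N => [|N IH] /=; first exact: ideal_pow0.
  have wS : ideal_pow S N (w N) by apply: (idealD (HS N)).
  by have [] := FP (N, w N) wS.
have wS N : ideal_pow S N (w N) by apply: (idealD (HS N)).
have FPw N := FP (N, w N) (wS N).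
have bN N : order_ge N.*2 (b N) by have [[bN _] _ _] := FPw N.
have gN N i : ideal_pow S N.-1 (g N i) by have [[_ H] _ _] := FPw N; apply: H.
have wE N : w N = tl (b N) + \sum_i D i * g N i + rem N.+1 by have [_ _ wE] := FPw N.
have yE N : y N = \sum_(j < N) (tl (b j) + \sum_i D i * g j i) + rem N.
  elim: N => [|N IH]; first by rewrite big_ord0 add0r.
  rewrite big_ord_recr /= -addrA -[X in _ = _ + X]wE /w addrA -IH.
  by rewrite addrC subrK.
have Gcoh i : (fun N => \sum_(j < N.+1) g j i) \in coherent S.
  apply/asboolP => N; have -> : \sum_(j < N.+2) g j i - \sum_(j < N.+1) g j i = g N.+1 i.
    by rewrite big_ord_recr /= addrC addrK.
  exact: (gN N.+1 i).
exists (cusp_series b), (fun i => quot_proj (@null_seq _ S) (CoherentSeq (Gcoh i))).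
set r := cusp_series b.
transitivity (quot_proj (@null_seq _ S) (const_seq S (tl r) +
    \sum_i const_seq S (D i) * CoherentSeq (Gcoh i))); last first.
  rewrite rmorphD rmorph_sum; congr (_ + _).
  by apply: eq_bigr => i _; rewrite rmorphM !rmorphB.
apply/quot_projP; apply: span_sub => N.
have -> : (y - (const_seq S (tl r) + \sum_i const_seq S (D i) * CoherentSeq (Gcoh i))) N
  = rem N - tl (r - \sum_(j < N) b j) - \sum_i D i * g N i :> T.
  transitivity (y N - (tl r + \sum_i D i * (\sum_(j < N.+1) g j i))).
    congr (_ - (_ + _)).
    exact: (big_morph (fun u : coherent_seq S => u N)).
  have -> : \sum_i D i * (\sum_(j < N.+1) g j i) =
      \sum_(j < N) (\sum_i D i * g j i) + \sum_i D i * g N i.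
    rewrite exchange_big -big_split; apply: eq_bigr => i _ /=.
    by rewrite big_ord_recr mulrDr mulr_sumr.
  rewrite yE big_split /= rmorphB rmorph_sum; ring.
apply: (idealB (HS _)); first apply: (idealB (HS _)) => //.
  by apply: order_ge_pow gen_l _; apply: cusp_seriesE.
apply: ideal_sum => // i; rewrite mulrBl.
by apply: (idealB (HS _)); apply: ideal_pow_pred => //; [apply: gen_l|apply: gen_r].
Qed.

End Cusp.

(** * Powers of an ideal, saturated *)

(** [sat_pow j] consists of the elements lying in the [j]-th power up to torsion
    killed by powers of [a]. *)
Section Saturation.
Variables (C : comPzRingType) (S : set C) (a : C).

Definition sat_pow (j : nat) : set C := [set z | exists L, ideal_pow S j (a ^+ L * z)].

Lemma sat_powM i j y z : sat_pow i y -> sat_pow j z -> sat_pow (i + j) (y * z).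
Proof.
move=> [L yS] [L' zS]; exists (L + L')%N.
by rewrite exprD mulrACA; apply: ideal_powM.
Qed.

Lemma sat_powX i m y : sat_pow i y -> sat_pow (i * m) (y ^+ m).
Proof.
move=> yi; elim: m => [|m IH]; last by rewrite mulnS exprS; apply: sat_powM.
by exists 0%N; rewrite muln0; apply: ideal_pow0.
Qed.

Lemma sat_pow_le i j z : (i <= j)%N -> sat_pow j z -> sat_pow i z.
Proof. by move=> ij [L zL]; exists L; apply: ideal_pow_le zL. Qed.

Lemma sat_pow_ideal j : ideal (sat_pow j).
Proof.
have HI := ideal_pow_ideal S j; apply: idealP => [|y z [L yL] [L' zL]|b y [L yL]].
- by exists 0%N; rewrite mulr0; apply: ideal0.
- exists (L + L')%N; rewrite mulrDr exprD -[in X in _ (_ + X)]mulrA.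
  apply: (idealD HI); last exact: (ideal_mull HI).
  by rewrite mulrAC; apply: (ideal_mulr HI).
- by exists L; rewrite mulrCA; apply: (ideal_mull HI).
Qed.

End Saturation.

(** * A staircase basis *)

(** The powers of [W] below the [p]-th generate [C] over [R] modulo the multiples
    of [P], and [P] counts as [p] factors in the powers of the ideal, up to
    torsion. *)
Section Staircase.
Variables (R C : comPzRingType) (cl : {rmorphism R -> C}) (S : set C) (a : R).
Variables (p : nat) (P W : C).
Hypothesis p0 : (0 < p)%N.
Hypothesis gen : forall z : C, exists (c : 'I_p -> R) z',
  z = \sum_i cl (c i) * W ^+ i + P * z'.
Hypothesis Psat : sat_pow S (cl a) p P.
Hypothesis Wsat : sat_pow S (cl a) 1 W.

Definition stair (j : nat) : C := P ^+ (j %/ p) * W ^+ (j %% p).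

Lemma stair_sat j : sat_pow S (cl a) j (stair j).
Proof.
rewrite [j in sat_pow _ _ j](divn_eq j p) mulnC; apply: sat_powM; first exact: sat_powX.
by have := sat_powX (j %% p) Wsat; rewrite mul1n.
Qed.

(** Iterating [gen]: the quotient of one expansion is expanded in turn. *)
Lemma stair_expansion (z : C) L : exists (c : nat -> R) z',
  z = \sum_(j < L * p) cl (c j) * stair j + P ^+ L * z'.
Proof.
elim: L => [|L [c [z' ->]]]; first by exists (fun=> 0), z; rewrite mul0n big_ord0 add0r mul1r.
have [c' [z'' ->]] := gen z'.
exists (fun j => if (j < L * p)%N then c j else oapp c' 0 (insub (j - L * p)%N)), z''.
rewrite mulSnr big_split_ord /= -addrA; congr (_ + _).
  by apply: eq_bigr => j _; rewrite ltn_ord.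
rewrite mulrDr mulrA -exprSr mulr_sumr; congr (_ + _); apply: eq_bigr => i _.
rewrite ltnNge leq_addr /= addKn valK /= mulrCA /stair.
by rewrite divnMDl // divn_small // addn0 modnMDl modn_small.
Qed.

(** Expanding far enough, all terms from the [n]-th on lie in the saturated [n]-th
    power. *)
Lemma stair_gen n (z : C) : exists c : nat -> R,
  sat_pow S (cl a) n (z - \sum_(j < n) cl (c j) * stair j).
Proof.
have [c [z' ->]] := stair_expansion z n; exists c.
have HI := @sat_pow_ideal _ S (cl a) n.
have [m ->] : exists m, (n * p = n + m)%N.
  by exists (n * p - n)%N; rewrite subnKC // leq_pmulr.
rewrite big_split_ord /=; set X := \sum_(_ < n) _; set Y := \sum_(_ < m) _.
have -> : X + Y + P ^+ n * z' - X = Y + P ^+ n * z' by ring.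
apply: (idealD HI).
  apply: ideal_sum => // j; apply: (ideal_mull HI).
  by apply: sat_pow_le (stair_sat (n + j)); rewrite leq_addr.
apply: (ideal_mulr HI); apply: sat_pow_le (sat_powX n Psat).
by rewrite leq_pmull.
Qed.

End Staircase.
(** * The expansion along the diagonal *)

Section Diagonal.
Variable k : comPzRingType.
Local Notation R := (cusp k).
Local Notation cst := (@cusp_const k).
Local Notation x := (@cusp_coord k).
Local Notation C := (ctensor cst x).
Local Notation cl := (ctensl cst x).
Local Notation cr := (ctensr cst x).
Local Notation W := (pseries (pseries k)).

Fact cusp_val_zmod : zmod_morphism (@cusp_val k). Proof. by []. Qed.
Fact cusp_val_monoid : monoid_morphism (@cusp_val k). Proof. by []. Qed.
HB.instance Definition _ :=
  GRing.isZmodMorphism.Build R (pseries k) (@cusp_val k) cusp_val_zmod.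
HB.instance Definition _ :=
  GRing.isMonoidMorphism.Build R (pseries k) (@cusp_val k) cusp_val_monoid.

Definition expand_l : R -> W := @pconst (pseries k) \o @cusp_val k.
Definition expand_r : R -> W := @taylor k \o @cusp_val k.
HB.instance Definition _ := GRing.RMorphism.on expand_l.
HB.instance Definition _ := GRing.RMorphism.on expand_r.

Fact expand_scalar (a : k) : expand_l (cst a) = expand_r (cst a).
Proof. exact/esym/taylor_const. Qed.

Definition expand_tensor : tensor_ring cst cst -> W := tensor_lift expand_scalar.
HB.instance Definition _ := GRing.RMorphism.on expand_tensor.

Fact expand_tensor_gen t :
  (exists i, t = tensl cst cst (x i) \/ t = tensr cst cst (x i)) ->
  deg_ge 1 (expand_tensor t).
Proof.
move=> [i [->|->]] [|j] [|m] // _; rewrite [expand_tensor _]tensor_liftE rmorph1 ?mul1r ?mulr1.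
all: by rewrite -[LHS]/(monomial k (i + 2) 0%N) /monomial addn2.
Qed.

(** The substitution of x + t for the second variable. *)
Definition expand : C -> W := completion_lift expand_tensor_gen.
HB.instance Definition _ := GRing.RMorphism.on expand.

Lemma expand_const t : expand (to_completion _ t) = expand_tensor t.
Proof.
rewrite [LHS]quot_liftE; apply: lim_lift_uniq => N /=.
by rewrite subrr.
Qed.

Lemma expand_ctensl b : expand (cl b) = pconst (cusp_val b).
Proof. by rewrite [LHS]expand_const [LHS]tensor_liftE rmorph1 mulr1. Qed.

Lemma expand_ctensr b : expand (cr b) = taylor (cusp_val b).
Proof. by rewrite [LHS]expand_const [LHS]tensor_liftE rmorph1 mul1r. Qed.

(** The generators of the diagonal ideal, f(x) - f(x + t), vanish at t = 0. *)
Lemma expand_pow n z : ideal_pow (@diag_gen _ _ cst _ x) n z ->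
  forall j, (j < n)%N -> expand z j = 0.
Proof.
move: z; apply: (@ideal_pow_min _ _ _ [set z | forall j, (j < n)%N -> expand z j = 0]).
  apply: idealP => [j|y z yn zn j|a y yn j] jn.
  - by rewrite rmorph0.
  - by rewrite rmorphD pseriesD /= yn // zn // addr0.
  - rewrite rmorphM pseriesM big1 //= => i _; rewrite yn ?mulr0 //.
    by apply: leq_ltn_trans jn; apply: leq_subr.
elim: n => [//|n IH] s sS j jn; rewrite big_ord_recl rmorphM pseriesM big1 //= => -[[|i] ij] _ /=.
  have [l ->] := sS ord0; rewrite rmorphB /= expand_ctensl expand_ctensr.
  suff -> : (pconst (cusp_val (x l)) - taylor (cusp_val (x l))) 0%N = 0 by rewrite mul0r.
  apply/funext => m; rewrite [LHS](_ : _ = cusp_val (x l) m - cusp_val (x l) (m + 0)%N *+ 'C(m + 0, 0)) //.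
  by rewrite addn0 bin0 mulr1n subrr.
by rewrite [X in _ * X]IH ?mulr0 //; lia.
Qed.

Section Independence.
Variables (p : nat) (P Q : C) (a b : pseries k).
Hypothesis dom : is_domain k.
Hypothesis p0 : (0 < p)%N.
Hypothesis a0 : a <> 0.
Hypothesis b0 : b <> 0.
Hypothesis Plead : has_lead p a (expand P).
Hypothesis Qlead : has_lead 1 b (expand Q).

(** The element [stair j] has order exactly [j] in t, so the coefficients vanish
    one after the other: the first nonzero one would contribute a lowest term
    that nothing cancels. *)
Lemma stair_indep n (c : 'I_n -> R) :
  ideal_pow (@diag_gen _ _ cst _ x) n (\sum_i cl (c i) * stair p P Q i) ->
  forall i, c i = 0.
Proof.
move=> /expand_pow E i.
have [j ij] : exists j, (i < j)%N by exists i.+1.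
elim: j i ij => // j IH i ij.
have domW := pseries_domain dom.
have := E i (ltn_ord i); rewrite rmorph_sum pseries_sum.
have lead l : has_lead l (a ^+ (l %/ p) * b ^+ (l %% p)) (expand (stair p P Q l)).
  rewrite [l in has_lead l _ _](divn_eq l p) [expand _]rmorphM !rmorphXn mulnC.
  by apply: has_leadM; [apply: has_leadX|have := has_leadX (l %% p) Qlead; rewrite mul1n].
rewrite (bigD1 i) //= big1 ?addr0 => [|l li]; rewrite rmorphM /= expand_ctensl pconstM.
  rewrite (lead i).2 mulrC -mulrA => /(domain_expI domW a0)/(domain_expI domW b0) ci0.
  exact: cusp_val_inj.
have {li} := li; rewrite -val_eqE /= neq_ltn => /orP[li|il].
  by rewrite IH ?mul0r ?rmorph0 ?mul0r //; lia.
by rewrite (lead l).1 // mulr0.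
Qed.

End Independence.

End Diagonal.

(** * Principal parts of the cusp *)

Section PrincipalPartsOfCusp.
Variable k : comPzRingType.
Local Notation R := (cusp k).
Local Notation cst := (@cusp_const k).
Local Notation x := (@cusp_coord k).
Local Notation C := (ctensor cst x).
Local Notation cl := (ctensl cst x).
Local Notation cr := (ctensr cst x).
Local Notation S := (@diag_gen _ _ cst _ x).

(** The staircase below [n.+1] is a basis of the principal parts modulo torsion. *)
Theorem staircase_nash (p : nat) (P Q : C) (a b : pseries k) n :
  is_domain k -> (0 < p)%N ->
  (forall z : C, exists (c : 'I_p -> R) z', z = \sum_i cl (c i) * Q ^+ i + P * z') ->
  sat_pow S (cl (x ord0)) p P -> sat_pow S (cl (x ord0)) 1 Q ->
  a <> 0 -> b <> 0 -> has_lead p a (expand P) -> has_lead 1 b (expand Q) ->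
  (exists U, nash_open (principal_parts cst x n) n.+1 U) /\
  (forall U, nash_open (principal_parts cst x n) n.+1 U ->
     iso_base (nash (principal_parts cst x n) n.+1 U)).
Proof.
move=> dom p0 gen Psat Qsat a0 b0 Plead Qlead.
pose M := principal_parts cst x n.
pose q : C -> M := @quot_proj C (ideal_pow S n.+1).
have qZ (r : R) z : r *: q z = q (cl r * z) by rewrite [RHS]rmorphM.
have qsum (c : 'I_n.+1 -> R) : \sum_i c i *: q (stair p P Q i) =
    q (\sum_i cl (c i) * stair p P Q i).
  by rewrite [RHS]rmorph_sum; apply: eq_bigr => i _; rewrite qZ.
have q0 z : ideal_pow S n.+1 z <-> q z = 0.
  rewrite -[0 : M]/(q 0) quot_projP subr0; split; first exact: span_sub.
  by apply: ideal_gen_min; first exact: ideal_pow_ideal.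
have tau0 : x ord0 <> 0.
  by move=> /(congr1 (fun f => cusp_val f 2)) /=; rewrite /monomial; case: dom.
have indep (c : 'I_n.+1 -> R) : \sum_i c i *: q (stair p P Q i) = 0 -> forall i, c i = 0.
  by rewrite qsum => /q0; apply: (stair_indep dom p0 a0 b0 Plead Qlead).
have tors (m : M) : exists (c : 'I_n.+1 -> R) N,
    x ord0 ^+ N *: (m - \sum_i c i *: q (stair p P Q i)) = 0.
  have [c [N cN]] := stair_gen p0 gen Psat Qsat n.+1 (repr (m : quot_ring _)).
  exists (fun i => c i), N; rewrite qsum.
  have -> : m = q (repr (m : quot_ring _)) by apply: quot_projE.
  have -> z z' : q z - q z' = q (z - z') by rewrite [RHS]rmorphB.
  by rewrite qZ; apply/q0; rewrite rmorphXn.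
have domR := cusp_domain dom.
split; first by exists [set u | ~ u (x ord0)]; apply: (nash_open_exists domR tau0 indep tors).
by move=> U; apply: (nash_iso_base domR tau0 indep tors).
Qed.

End PrincipalPartsOfCusp.

(** * Characteristics 2 and 3 *)

Section SmallCharacteristic.
Variable k : comPzRingType.
Hypothesis dom : is_domain k.
Local Notation R := (cusp k).
Local Notation cst := (@cusp_const k).
Local Notation x := (@cusp_coord k).
Local Notation C := (ctensor cst x).
Local Notation cl := (ctensl cst x).
Local Notation cr := (ctensr cst x).
Local Notation S := (@diag_gen _ _ cst _ x).
Local Notation diff i := (cr (x i) - cl (x i)).
Local Notation U := (diff ord0).
Local Notation V := (diff ord_max).

Lemma cusp_equation : x ord_max ^+ 2 = x ord0 ^+ 3.
Proof.
apply/cusp_val_inj/funext => n; rewrite !exprS expr0 !mulr1.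
by rewrite !cusp_valM !monomialM /monomial; case: n => [|[|[|[|[|[|[|n]]]]]]].
Qed.

Lemma cl_equation : cl (x ord_max) ^+ 2 = cl (x ord0) ^+ 3.
Proof. by rewrite -!rmorphXn cusp_equation. Qed.

Lemma diff_equation :
  (cl (x ord_max) + V) ^+ 2 = (cl (x ord0) + U) ^+ 3.
Proof. by rewrite !(addrC (cl _)) !subrK -!rmorphXn cusp_equation. Qed.

Lemma difmap_pow_deg_ge1 i : ideal_pow S 1 (diff i).
Proof.
rewrite -opprB; apply: (idealN (ideal_pow_ideal S 1)); apply: ideal_pow1.
by exists i.
Qed.

Lemma diff_sat i : sat_pow S (cl (x ord0)) 1 (diff i).
Proof. by exists 0%N; rewrite mul1r; apply: difmap_pow_deg_ge1. Qed.

Lemma ctensor_decomp2 (z : C) : exists (r : R) u v, z = cl r + U * u + V * v.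
Proof.
have [r [G ->]] := ctensor_decomp z; exists r, (- G ord0), (- G ord_max).
by rewrite big_ord_recl big_ord1 (_ : lift ord0 ord0 = ord_max) ?addrA; [ring|apply: val_inj].
Qed.

Lemma expand_diff i j m : expand (diff i) j.+1 m = (m + j.+1 == i + 2)%N%:R *+ 'C(m + j.+1, j.+1).
Proof.
rewrite rmorphB /= expand_ctensl expand_ctensr.
transitivity (taylor (monomial k (i + 2)) j.+1 m - 0); first by [].
by rewrite subr0.
Qed.

Lemma expand_diff0 i : expand (diff i) 0%N = 0.
Proof. by apply: (expand_pow (difmap_pow_deg_ge1 i)). Qed.

Lemma cst_nat p : p%:R = 0 :> k -> p%:R = 0 :> C.
Proof. by move=> pk; rewrite -(rmorph_nat cl) -(rmorph_nat cst) pk !rmorph0. Qed.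

Lemma monomial_neq0 m : monomial k m <> 0.
Proof. by move=> /(congr1 (fun f : pseries k => f m)); rewrite /monomial eqxx; case: dom. Qed.

(** Here [diff 0] = t^2 and [diff 1] = x^2 t + x t^2 + t^3 after the substitution. *)
Lemma nash_char2 n : 2%:R = 0 :> k ->
  (exists O, nash_open (principal_parts cst x n) n.+1 O) /\
  (forall O, nash_open (principal_parts cst x n) n.+1 O ->
     iso_base (nash (principal_parts cst x n) n.+1 O)).
Proof.
move=> k2; have C2 := cst_nat k2; have D2 := diff_equation; have D1 := cl_equation.
set a := cl (x ord0) in D1 D2; set b := cl (x ord_max) in D1 D2.
(* The equation of the cusp in characteristic 2. It expands V^2 in multiples of U,
   and shows that a^2 U lies in the square of the diagonal ideal. *)
have EV : V ^+ 2 = U * (U ^+ 2 + a * U + a ^+ 2).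
  have -> : V ^+ 2 = (b + V) ^+ 2 - b ^+ 2 - 2%:R * (b * V) by ring.
  have -> : U * (U ^+ 2 + a * U + a ^+ 2) =
    (a + U) ^+ 3 - a ^+ 3 - 2%:R * (a * U ^+ 2 + a ^+ 2 * U) by ring.
  by rewrite D2 D1 C2 !mul0r.
apply: (@staircase_nash k 2 U V (monomial k 0) (monomial k 2)) => //.
- move=> z; have [r [u [v ->]]] := ctensor_decomp2 z.
  have [r' [u' [v' ->]]] := ctensor_decomp2 v.
  exists (fun i : 'I_2 => if i == 0%N :> nat then r else r'),
    (u + V * u' + (U ^+ 2 + a * U + a ^+ 2) * v').
  rewrite big_ord_recl big_ord1 /= expr0 expr1 mulr1.
  have -> : cl r + U * u + V * (cl r' + U * u' + V * v') =
    cl r + cl r' * V + U * (u + V * u') + V ^+ 2 * v' by ring.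
  by rewrite EV; ring.
- exists 2%N; have -> : a ^+ 2 * U = V ^+ 2 - U ^+ 2 * (U + a).
    by rewrite EV; ring.
  have HI := ideal_pow_ideal S 2; apply: (idealB HI).
    by have := ideal_powX 2 (difmap_pow_deg_ge1 ord_max).
  by apply: (ideal_mulr HI); have := ideal_powX 2 (difmap_pow_deg_ge1 ord0).
- exact: diff_sat.
- exact: monomial_neq0.
- exact: monomial_neq0.
- split=> [[|[|]] // _|]; rewrite ?expand_diff0 //; apply/funext => m; rewrite expand_diff.
    by rewrite addn1 addn2; case: m => [|[|m]] //=; rewrite ?mul0rn //; exact: k2.
  by rewrite !addn2 /monomial; case: m => [|[|m]] //=; rewrite ?mul0rn.
- split=> [[|] // _|]; rewrite ?expand_diff0 //; apply/funext => m; rewrite expand_diff.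
  rewrite addn1 addn2 /monomial; case: m => [|[|[|m]]] //=; rewrite ?mul0rn // bin1.
  by rewrite -[3%N]/(2 + 1)%N mulrnDr k2 add0r.
Qed.

(** Here [diff 1] = t^3 and [diff 0] = 2 x t + t^2 after the substitution. *)
Lemma nash_char3 n : 3%:R = 0 :> k ->
  (exists O, nash_open (principal_parts cst x n) n.+1 O) /\
  (forall O, nash_open (principal_parts cst x n) n.+1 O ->
     iso_base (nash (principal_parts cst x n) n.+1 O)).
Proof.
move=> k3; have C3 := cst_nat k3; have D2 := diff_equation; have D1 := cl_equation.
set a := cl (x ord0) in D1 D2; set b := cl (x ord_max) in D1 D2.
(* The equation of the cusp in characteristic 3. It expands U^3 in multiples of V,
   and shows that b^2 V = a^3 V lies in the cube of the diagonal ideal. *)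
have EU : U ^+ 3 = V * (V + 2%:R * b).
  have -> : V * (V + 2%:R * b) = (b + V) ^+ 2 - b ^+ 2 by ring.
  have -> : U ^+ 3 = (a + U) ^+ 3 - a ^+ 3 - 3%:R * (a * U ^+ 2 + a ^+ 2 * U) by ring.
  by rewrite D2 D1 C3 mul0r subr0.
apply: (@staircase_nash k 3 V U (monomial k 0) (expand U 1%N)) => //.
- move=> z; have [r [u [v ->]]] := ctensor_decomp2 z.
  have [r' [u' [v' ->]]] := ctensor_decomp2 u.
  have [r2 [u2 [v2 ->]]] := ctensor_decomp2 u'.
  exists (fun i : 'I_3 => if i == 0%N :> nat then r else if i == 1%N :> nat then r' else r2),
    (v + U * v' + U ^+ 2 * v2 + (V + 2%:R * b) * u2).
  rewrite !big_ord_recl big_ord0 /= expr0 expr1 mulr1 addr0.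
  have -> : cl r + U * (cl r' + U * (cl r2 + U * u2 + V * v2) + V * v') + V * v =
    cl r + (cl r' * U + cl r2 * U ^+ 2) + V * (v + U * v' + U ^+ 2 * v2) + U ^+ 3 * u2 by ring.
  by rewrite EU; ring.
- exists 3%N; have -> : a ^+ 3 * V = V ^+ 3 + U ^+ 3 * (2%:R * b - V).
    rewrite EU -D1; transitivity (b ^+ 2 * V + 3%:R * (b ^+ 2 * V)); last by ring.
    by rewrite C3 mul0r addr0.
  have HI := ideal_pow_ideal S 3; apply: (idealD HI).
    by have := ideal_powX 3 (difmap_pow_deg_ge1 ord_max).
  by apply: (ideal_mulr HI); have := ideal_powX 3 (difmap_pow_deg_ge1 ord0).
- exact: diff_sat.
- exact: monomial_neq0.
- move=> /(congr1 (fun f : pseries k => f 1%N)); rewrite expand_diff /= bin1 => k2.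
  case: dom => k1 _; apply: k1.
  by rewrite -[1](addrK (2%:R : k)) -mulrS k3 k2 subr0.
- split=> [[|[|[|]]] // _|]; rewrite ?expand_diff0 //; apply/funext => m; rewrite expand_diff.
  + by rewrite addn1 addn2; case: m => [|[|[|m]]] //=; rewrite ?mul0rn //; exact: k3.
  + by rewrite !addn2; case: m => [|[|m]] //=; rewrite ?mul0rn //; exact: k3.
  + by rewrite addn3 addn2 /monomial; case: m => [|[|m]] //=; rewrite ?mul0rn.
- by split=> // -[|] //; rewrite expand_diff0.
Qed.

End SmallCharacteristic.

Theorem proposition3p9 (k : closedFieldType)
    (hk : 2%N \in [pchar k] \/ 3%N \in [pchar k]) (n : nat) :
  (exists U : set (set (cusp k)),
     higher_nash_open (@cusp_const k) (@cusp_coord k) 1 n U) /\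
  (forall U : set (set (cusp k)),
     higher_nash_open (@cusp_const k) (@cusp_coord k) 1 n U ->
     iso_base (higher_nash (@cusp_const k) (@cusp_coord k) 1 n U)).
Proof.
have dom : is_domain k.
  by split=> [|a b /eqP]; [apply/eqP/oner_neq0|rewrite mulf_eq0 => /orP[]/eqP; [left|right]].
rewrite /higher_nash_open /higher_nash bin1 addn1.
by case: hk => /pcharf0; [apply: nash_char2|apply: nash_char3].
Qed.
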